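(* Let $\mathbb{K}=\mathbb{R}$ or $\mathbb{C}$, let $1\le p<\infty$, and let $(X,\mu,f)$ be an odometer system such that the composition operator $T_f:L^p(X;\mathbb{K})\to L^p(X;\mathbb{K})$, $T_f(\varphi)=\varphi\circ f$, is continuous. Then the following statements hold. (1) The set of periodic points of $T_f$ is dense in $L^p(X;\mathbb{K})$. (2) If $p\ge2$, then $T_f$ fails to satisfy the Frequent Hypercyclicity Criterion.
   Context: Odometer system. Let $(\alpha_n)_{n\ge1}$ be a sequence of integers with $\alpha_n\ge2$ for all $n$, let $A_n=\{0,\ldots,\alpha_n-1\}$ and let $X=\prod_{n=1}^\infty A_n$ with the product topology and its Borel $\sigma$-algebra $\mathcal{B}$. The odometer $f:X\to X$ is defined as follows: $f(\alpha_1-1,\alpha_2-1,\alpha_3-1,\ldots)=(0,0,0,\ldots)$, and for any other $x=(x_1,x_2,\ldots)$, with $l(x)=\min\{j\ge1:x_j\ne\alpha_j-1\}$, one sets $f(x)_n=0$ if $n<l(x)$, $f(x)_n=x_n+1$ if $n=l(x)$, and $f(x)_n=x_n$ if $n>l(x)$. For each $n\ge1$ let $\mu_n$ be a probability measure on $A_n$ with $\mu_n(a)>0$ for all $a\in A_n$, let $\mu=\prod_{n=1}^\infty\mu_n$ be the product probability on $X$, and assume $\prod_{n=1}^\infty\max\{\mu_n(a):a\in A_n\}=0$ (so $\mu$ is non-atomic). Any such triple $(X,\mu,f)$ is called an odometer system. $L^p(X;\mathbb{K})$ is taken with respect to $\mu$. Continuity of $T_f$ means that $\varphi\mapsto\varphi\circ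 f$ is a bounded linear operator of $L^p(X;\mathbb{K})$ into itself. A periodic point of an operator $T$ is a vector $x$ with $T^nx=x$ for some $n\ge1$. Frequent Hypercyclicity Criterion: a continuous linear operator $T$ on a separable Banach space $\mathcal{X}$ satisfies the criterion if there exist a dense subset $\mathcal{X}_0\subseteq\mathcal{X}$ and a map $S:\mathcal{X}_0\to\mathcal{X}_0$ such that for every $x\in\mathcal{X}_0$: (i) $\sum_{n=1}^\infty T^nx$ converges unconditionally; (ii) $\sum_{n=1}^\infty S^nx$ converges unconditionally; (iii) $TSx=x$. *)

(* Defs.v *)
From HB Require Import structures.
From mathcomp Require Import all_boot all_order all_algebra.
From mathcomp Require Import all_classical all_reals all_analysis.
From mathcomp Require Import measurable_realfun.
From mathcomp.real_closed Require Import complex.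

Set Implicit Arguments.
Unset Strict Implicit.
Unset Printing Implicit Defensive.

Import Order.TTheory GRing.Theory Num.Theory.
Import numFieldNormedType.Exports.

Local Open Scope classical_set_scope.
Local Open Scope ring_scope.

Inductive scalar_kind := RealScalars | ComplexScalars.

Definition scalars (R : realType) (k : scalar_kind) : numFieldType :=
  match k with RealScalars => R | ComplexScalars => R[i] end.

Section scalars.
Context {R : realType} {k : scalar_kind}.
Local Notation K := (scalars R k).

Definition scalar_re : K -> R :=
  match k return scalars R k -> R with
  | RealScalars => fun x => x | ComplexScalars => @complex.Re R end.

Definition scalar_im : K -> R :=
  match k return scalars R k -> R with
  | RealScalars => fun _ => 0 | ComplexScalars => @complex.Im R end.

Definition real_scalar : R -> K :=
  match k return R -> scalars R k with
  | RealScalars => fun x => x | ComplexScalars => fun x => (x%:C)%C end.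

(* The norm [`|x|] of a numFieldType has values in the field itself. *)
Definition modulus (x : K) : R := scalar_re `|x|.

End scalars.

Section scalars_theory.
Context (R : realType) (k : scalar_kind).
Local Notation K := (scalars R k).
Implicit Types x y : K.

Lemma real_scalar_inj : injective (@real_scalar R k).
Proof. by rewrite /real_scalar; case: k => x y // []. Qed.

Lemma real_scalar0 : real_scalar 0 = 0 :> K. Proof. by case: k. Qed.

Lemma real_scalarD (a b : R) : real_scalar (a + b) = real_scalar a + real_scalar b :> K.
Proof. by case: k => //=; rewrite rmorphD. Qed.

Lemma real_scalarM (a b : R) : real_scalar (a * b) = real_scalar a * real_scalar b :> K.
Proof. by case: k => //=; rewrite rmorphM. Qed.

Lemma ler_real_scalar (a b : R) :
  (real_scalar a <= real_scalar b :> K) = (a <= b).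
Proof. by case: k => //=; rewrite lecR. Qed.

Lemma real_scalar_modulus x : real_scalar (modulus x) = `|x| :> K.
Proof. by rewrite /modulus; case: k x => // -[a b]. Qed.

Lemma modulus_ge0 x : 0 <= modulus x.
Proof. by rewrite -ler_real_scalar real_scalar0 real_scalar_modulus. Qed.

Lemma modulusD x y : modulus (x + y) <= modulus x + modulus y.
Proof.
by rewrite -ler_real_scalar real_scalarD !real_scalar_modulus ler_normD.
Qed.

Lemma modulusM x y : modulus (x * y) = modulus x * modulus y.
Proof.
by apply: real_scalar_inj; rewrite real_scalarM !real_scalar_modulus normrM.
Qed.

Lemma modulus_eq0 x : modulus x = 0 -> x = 0.
Proof.
move=> h; apply/eqP; rewrite -normr_eq0 -real_scalar_modulus h.
by case: k {x h}.
Qed.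

Lemma modulus0 : modulus (0 : K) = 0.
Proof. by rewrite /modulus normr0; case: k. Qed.

Lemma modulus_reim x : modulus x = Num.sqrt (scalar_re x ^+ 2 + scalar_im x ^+ 2).
Proof.
rewrite /modulus; case: k x => /= x; last by case: x.
by rewrite expr0n addr0 sqrtr_sqr.
Qed.

Lemma scalar_reD x y : scalar_re (x + y) = scalar_re x + scalar_re y.
Proof. by case: k x y => // -[a b] [c d]. Qed.

Lemma scalar_imD x y : scalar_im (x + y) = scalar_im x + scalar_im y.
Proof. by case: k x y => [x y|[a b] [c d]] //=; rewrite addr0. Qed.

Lemma scalar_reM x y :
  scalar_re (x * y) = scalar_re x * scalar_re y - scalar_im x * scalar_im y.
Proof. by case: k x y => [x y|[a b] [c d]] //=; rewrite mulr0 subr0. Qed.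

Lemma scalar_imM x y :
  scalar_im (x * y) = scalar_re x * scalar_im y + scalar_im x * scalar_re y.
Proof. by case: k x y => [x y|[a b] [c d]] //=; rewrite mulr0 mul0r addr0. Qed.

Lemma scalar_re0 : scalar_re (0 : K) = 0. Proof. by case: k. Qed.
Lemma scalar_im0 : scalar_im (0 : K) = 0. Proof. by case: k. Qed.

End scalars_theory.

Section Lebesgue_functions.
Context d (T : measurableType d) (R : realType) (k : scalar_kind).
Variables (mu : {measure set T -> \bar R}) (p : R) (p1 : 1 <= p).
Local Notation K := (scalars R k).
Implicit Types phi psi : T -> K.

(* Equivalent to Borel measurability; the imaginary part is 0 for real scalars. *)
Definition scalar_measurable phi :=
  measurable_fun setT (scalar_re \o phi) /\
  measurable_fun setT (scalar_im \o phi).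

Definition scalar_Lnorm phi : \bar R :=
  'N[mu]_p%:E[EFin \o (modulus \o phi)]%E.

(* The unused proof is a key for the canonical [submod_closed] instance below. *)
Definition scalar_Lfun of 1 <= p : {pred (T -> K)} :=
  mem [set phi | scalar_measurable phi /\ (scalar_Lnorm phi < +oo)%E].

Lemma measurable_modulus phi :
  scalar_measurable phi -> measurable_fun setT (modulus \o phi).
Proof.
move=> [mre mim].
rewrite (_ : _ \o _ = (fun x : T =>
    Num.sqrt (scalar_re (phi x) ^+ 2 + scalar_im (phi x) ^+ 2))).
  apply: (measurableT_comp (continuous_measurable_fun (@sqrt_continuous R))).
  by apply: measurable_funD; exact: measurable_funX.
by apply/funext => x /=; rewrite modulus_reim.
Qed.

Lemma scalar_measurableD phi psi :
  scalar_measurable phi -> scalar_measurable psi -> scalar_measurable (phi + psi).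
Proof.
move=> [rf imf] [rg img]; split.
- rewrite (_ : _ \o _ = (scalar_re \o phi) \+ (scalar_re \o psi)).
    exact: measurable_funD.
  by apply/funext => x /=; rewrite scalar_reD.
- rewrite (_ : _ \o _ = (scalar_im \o phi) \+ (scalar_im \o psi)).
    exact: measurable_funD.
  by apply/funext => x /=; rewrite scalar_imD.
Qed.

Lemma scalar_measurableZ (a : K) phi :
  scalar_measurable phi -> scalar_measurable (a *: phi).
Proof.
move=> [rf imf]; split.
- rewrite (_ : _ \o _ = (cst (scalar_re a) \* (scalar_re \o phi)) \-
    (cst (scalar_im a) \* (scalar_im \o phi))).
    by apply: measurable_funB; apply: measurable_funM.
  by apply/funext => x /=; rewrite scalar_reM.
- rewrite (_ : _ \o _ = (cst (scalar_re a) \* (scalar_im \o phi)) \+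
    (cst (scalar_im a) \* (scalar_re \o phi))).
    by apply: measurable_funD; apply: measurable_funM.
  by apply/funext => x /=; rewrite scalar_imM.
Qed.

Lemma scalar_Lnorm0 : scalar_Lnorm 0 = 0%E.
Proof.
rewrite /scalar_Lnorm (_ : _ \o _ = cst 0%E).
  by rewrite Lnorm0// eqe gt_eqF// (lt_le_trans ltr01).
by apply/funext => x /=; rewrite modulus0.
Qed.

Lemma scalar_LnormD phi psi : scalar_measurable phi -> scalar_measurable psi ->
  (scalar_Lnorm (phi + psi)%R <= scalar_Lnorm phi + scalar_Lnorm psi)%E.
Proof.
move=> mf mg; rewrite /scalar_Lnorm.
have mf' := measurable_modulus mf; have mg' := measurable_modulus mg.
apply: (le_trans _ (minkowski_EFin _ mf' mg' p1)).
have p0 : 0 < p by exact: lt_le_trans p1.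
rewrite unlock /=; apply: gt0_ler_poweR.
- by rewrite invr_ge0 ltW.
- by rewrite in_itv /= leey integral_ge0.
- by rewrite in_itv /= leey integral_ge0.
apply: ge0_le_integral => //.
- apply/measurable_EFinP.
  apply: (@measurableT_comp _ _ _ _ _ _ (@powR R ^~ p)) => //.
  apply: measurableT_comp => //.
  by apply: measurable_modulus; exact: scalar_measurableD.
- apply/measurable_EFinP.
  apply: (@measurableT_comp _ _ _ _ _ _ (@powR R ^~ p)) => //.
  apply: measurableT_comp => //; exact: measurable_funD.
- move=> x _; rewrite lee_fin ge0_ler_powR ?nnegrE//; first exact: ltW.
  rewrite !ger0_norm ?addr_ge0 ?modulus_ge0//; exact: modulusD.
Qed.

Lemma scalar_LnormZ (a : K) phi : scalar_measurable phi ->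
  scalar_Lnorm (a *: phi) = ((modulus a)%:E * scalar_Lnorm phi)%E.
Proof.
move=> mf; rewrite /scalar_Lnorm unlock /=.
have p0 : 0 < p by exact: lt_le_trans p1.
under eq_integral => x _.
  rewrite (_ : modulus ((a *: phi) x) = modulus a * modulus (phi x)); last exact: modulusM.
  rewrite normrM powRM ?normr_ge0// EFinM.
  over.
rewrite ge0_integralZl//; last first.
  apply/measurable_EFinP.
  apply: (@measurableT_comp _ _ _ _ _ _ (@powR R ^~ p)) => //.
  by apply: measurableT_comp => //; exact: measurable_modulus.
rewrite poweRM ?integral_ge0 ?lee_fin ?powR_ge0//.
by rewrite poweR_EFin -powRrM mulfV ?gt_eqF// powRr1// ger0_norm ?modulus_ge0.
Qed.

Lemma scalar_Lfun_submod_closed : submod_closed (scalar_Lfun p1).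
Proof.
have m0 : scalar_measurable 0.
  by split; rewrite (_ : _ \o _ = cst 0) //; apply/funext => x /=;
    rewrite ?scalar_re0 ?scalar_im0.
split; first by rewrite inE /=; split => //; rewrite scalar_Lnorm0.
move=> a f g; rewrite !inE /= => -[mf lf] [mg lg].
have maf := scalar_measurableZ a mf.
split; first exact: scalar_measurableD.
apply: le_lt_trans (scalar_LnormD maf mg) _.
by rewrite scalar_LnormZ// lte_add_pinfty// lte_mul_pinfty ?lee_fin ?modulus_ge0.
Qed.

HB.instance Definition _ :=
  GRing.isSubmodClosed.Build _ _ (scalar_Lfun p1) scalar_Lfun_submod_closed.

End Lebesgue_functions.

Section Lebesgue_space.
Context d (T : measurableType d) (R : realType) (k : scalar_kind).
Variables (mu : {measure set T -> \bar R}) (p : R) (p1 : 1 <= p).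
Local Notation K := (scalars R k).

Record LpFun := MkLpFun {
  LpFun_fun :> T -> K;
  LpFun_subproof : LpFun_fun \in scalar_Lfun mu p1 }.

HB.instance Definition _ := [isSub for LpFun_fun].
HB.instance Definition _ := [Choice of LpFun by <:].
HB.instance Definition _ := [SubChoice_isSubLmodule of LpFun by <:].

Definition null_LpFun : {pred LpFun} :=
  mem [set phi : LpFun | {ae mu, forall x, phi x = 0}].

Lemma null_LpFun_submod_closed : submod_closed null_LpFun.
Proof.
split; first by rewrite inE /=; exact: aeW.
move=> a f g; rewrite !inE /= => f0 g0.
move: f0 g0; apply: filterS2 => x fx gx.
by change (a * f x + g x = 0); rewrite fx gx mulr0 addr0.
Qed.

HB.instance Definition _ :=
  GRing.isSubmodClosed.Build _ _ null_LpFun null_LpFun_submod_closed.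

Definition Lp : Type := Quotient.quot null_LpFun.

HB.instance Definition _ := GRing.Zmodule.on Lp.
HB.instance Definition _ := EqQuotient.on Lp.
HB.instance Definition _ := ZmodQuotient.on Lp.

Definition Lp_class : LpFun -> Lp := \pi_Lp%qT.

Lemma Lp_classP (f g : LpFun) :
  Lp_class f = Lp_class g <-> {ae mu, forall x, f x = g x}.
Proof.
have -> : (Lp_class f = Lp_class g) <-> (f - g \in null_LpFun).
  by rewrite Quotient.idealrBE; split => [fg|/eqP//]; apply/eqP; exact: fg.
rewrite inE /=; split; apply: filterS => x.
  by move=> /= fg; apply/eqP; rewrite -subr_eq0; apply/eqP; exact: fg.
by move=> fg; change (f x - g x = 0); rewrite fg subrr.
Qed.

Lemma Lp_classK (v : Lp) : Lp_class (repr v) = v.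
Proof. exact: reprK. Qed.

Lemma Lp_classD (f g : LpFun) : Lp_class (f + g) = Lp_class f + Lp_class g.
Proof. by rewrite /Lp_class !piE. Qed.

Lemma Lp_repr_class (f : LpFun) :
  {ae mu, forall x, (repr (Lp_class f) : LpFun) x = f x}.
Proof. by apply/Lp_classP; rewrite Lp_classK. Qed.

Definition Lp_scale (a : K) (v : Lp) : Lp := Lp_class (a *: repr v).

Lemma Lp_scale_class a (f : LpFun) :
  Lp_scale a (Lp_class f) = Lp_class (a *: f).
Proof.
apply/Lp_classP; apply: filterS (Lp_repr_class f) => x fx.
by change (a * (repr (Lp_class f) : LpFun) x = a * f x); rewrite fx.
Qed.

Let Lp_scaleA a b v : Lp_scale a (Lp_scale b v) = Lp_scale (a * b) v.
Proof. by rewrite -[v]Lp_classK !Lp_scale_class scalerA. Qed.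

Let Lp_scale1 : left_id 1 Lp_scale.
Proof. by move=> v; rewrite -[v]Lp_classK !Lp_scale_class scale1r. Qed.

Let Lp_scaleDr : right_distributive Lp_scale +%R.
Proof.
move=> a u v; rewrite -[u]Lp_classK -[v]Lp_classK -Lp_classD !Lp_scale_class.
by rewrite scalerDr Lp_classD.
Qed.

Let Lp_scaleDl v : {morph Lp_scale^~ v : a b / a + b}.
Proof.
by move=> a b; rewrite -[v]Lp_classK !Lp_scale_class scalerDl Lp_classD.
Qed.

HB.instance Definition _ := GRing.Zmodule_isLmodule.Build K Lp
  Lp_scaleA Lp_scale1 Lp_scaleDr Lp_scaleDl.

(* The norm of a [normedModType K] has values in [K], hence the embedding. *)
Definition Lp_norm (v : Lp) : K := real_scalar (fine (scalar_Lnorm mu p (repr v))).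

Lemma LpFun_measurable (f : LpFun) : scalar_measurable f.
Proof. by have := valP f; rewrite inE => -[]. Qed.

Lemma LpFun_Lnorm_fin_num (f : LpFun) : scalar_Lnorm mu p f \is a fin_num.
Proof.
by have := valP f; rewrite inE => -[_ fy]; rewrite ge0_fin_numE// Lnorm_ge0.
Qed.

Lemma scalar_Lnorm_ae (f g : LpFun) : {ae mu, forall x, f x = g x} ->
  scalar_Lnorm mu p f = scalar_Lnorm mu p g.
Proof.
move=> fg; rewrite /scalar_Lnorm unlock; congr poweR.
have mabs (h : LpFun) :
    measurable_fun setT (fun x => (`|(EFin \o (modulus \o h)) x| `^ p)%E).
  apply/measurable_EFinP.
  apply: (@measurableT_comp _ _ _ _ _ _ (@powR R ^~ p)) => //.
  by apply: measurableT_comp => //; apply: measurable_modulus; exact: LpFun_measurable.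
apply: ae_eq_integral => //; apply: filterS fg => x fgx _ /=.
by rewrite fgx.
Qed.

Lemma Lp_norm_class (f : LpFun) :
  Lp_norm (Lp_class f) = real_scalar (fine (scalar_Lnorm mu p f)).
Proof.
by rewrite /Lp_norm (scalar_Lnorm_ae (Lp_repr_class f)).
Qed.

Let Lp_normD u v : Lp_norm (u + v) <= Lp_norm u + Lp_norm v.
Proof.
rewrite -[u]Lp_classK -[v]Lp_classK -Lp_classD !Lp_norm_class -real_scalarD.
rewrite ler_real_scalar -lee_fin EFinD !fineK ?LpFun_Lnorm_fin_num//.
by apply: scalar_LnormD => //; exact: LpFun_measurable.
Qed.

Let Lp_normZ a v : Lp_norm (a *: v) = `|a| * Lp_norm v.
Proof.
rewrite -[v]Lp_classK (_ : a *: _ = Lp_class (a *: repr v)); last first.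
  exact: Lp_scale_class.
rewrite !Lp_norm_class -real_scalar_modulus -real_scalarM; congr real_scalar.
apply: EFin_inj; rewrite EFinM !fineK ?LpFun_Lnorm_fin_num//.
by apply: scalar_LnormZ => //; exact: LpFun_measurable.
Qed.

Let Lp_norm0_eq0 v : Lp_norm v = 0 -> v = 0.
Proof.
rewrite -[v]Lp_classK Lp_norm_class -(real_scalar0 R k) => /real_scalar_inj f0.
have {}f0 : scalar_Lnorm mu p (repr v) = 0%E.
  by rewrite -[LHS]fineK ?LpFun_Lnorm_fin_num// f0.
rewrite (_ : 0 = Lp_class 0); last by rewrite /Lp_class piE.
have mf := measurable_modulus (LpFun_measurable (repr v)).
apply/Lp_classP; apply: filterS (Lnorm_eq0_eq0 _ _ f0).
- by move=> x /(_ I) [] /modulus_eq0.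
- exact/measurable_EFinP.
- by rewrite lte_fin (lt_le_trans ltr01).
Qed.

HB.instance Definition _ := Lmodule_isNormed.Build K Lp
  Lp_normD Lp_normZ Lp_norm0_eq0.

End Lebesgue_space.

Section dynamics.
Context {K : numFieldType} {V : normedModType K}.
Implicit Types (T : V -> V) (u : V ^nat).

Definition periodic_points T : set V :=
  [set v | exists2 n, (0 < n)%N & iter n T v = v].

Definition unconditionally_convergent u :=
  forall s : nat -> nat, bijective s -> cvgn (series (u \o s)).

(* The series start at the first power: [iter n.+1 T v] is T^(n+1) v, n >= 0.
   A map of [V0] into itself is represented by a map on [V] preserving [V0]. *)
Definition frequent_hypercyclicity_criterion T :=
  exists V0 : set V, dense V0 /\
  exists2 S : V -> V, set_fun V0 V0 S &
    forall v, V0 v ->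
      [/\ unconditionally_convergent (fun n => iter n.+1 T v),
          unconditionally_convergent (fun n => iter n.+1 S v) &
          T (S v) = v].

End dynamics.

(* [Tf] is the operator [phi |-> phi \o f] of L^p; in particular [phi \o f] is
   in L^p, and only depends on [phi] up to a null set, for [phi] in L^p. *)
Definition is_composition_operator d (T : measurableType d) (R : realType)
    (k : scalar_kind) (mu : {measure set T -> \bar R}) (p : R) (p1 : 1 <= p)
    (f : T -> T) (Tf : Lp k mu p1 -> Lp k mu p1) :=
  forall phi : LpFun k mu p1, exists2 psi : LpFun k mu p1,
    psi = phi \o f :> (T -> scalars R k) & Tf (Lp_class phi) = Lp_class psi.

Section odometer.
Context (alpha : nat -> nat) (alpha2 : forall n, (2 <= alpha n)%N).

(* Coordinates are numbered from 0. *)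
Definition digit of forall n, (2 <= alpha n)%N := fun n : nat => 'I_(alpha n).
Local Notation A := (digit alpha2).

Definition digit0 n : A n := Ordinal (ltnW (alpha2 n)).

HB.instance Definition _ n := Finite.on (A n).
HB.instance Definition _ n := isPointed.Build (A n) (digit0 n).
HB.instance Definition _ n :=
  DiscreteTopology.copy (A n) (discrete_topology 'I_(alpha n)).
HB.instance Definition _ n := @isMeasurable.Build default_measure_display (A n)
  (@discrete_measurable (A n)) discrete_measurable0
  (@discrete_measurableC (A n)) (@discrete_measurableU (A n)).

Definition odometer_topological_space : Type :=
  prod_topology (fun n => A n : topologicalType).
HB.instance Definition _ := Topological.copy odometer_topological_space
  (prod_topology (fun n => A n : topologicalType)).
HB.instance Definition _ :=
  isPointed.Build odometer_topological_space (fun n => digit0 n).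

Definition odometer_space :=
  g_sigma_algebraType (@open odometer_topological_space).
HB.instance Definition _ := Measurable.on odometer_space.

Implicit Types x : odometer_space.

Definition not_last_digit x n := x n != (alpha n).-1 :> nat.

(* [ordS i] is [i.+1 %% n] for [i : 'I_n], that is [i.+1] when [i != n.-1]. *)
Definition odometer x : odometer_space :=
  match pselect (exists j, not_last_digit x j) with
  | left ex => let l := ex_minn ex in
      fun n => if (n < l)%N then digit0 n
               else if n == l then ordS (x n) else x n
  | right _ => fun n => digit0 n
  end.

Context {R : realType}.

(* The rectangles with finitely many nontrivial sides form a pi-system that
   generates the Borel sigma-algebra, so [mu] is determined by [mu_]. *)
Definition is_product_measure (mu_ : forall n, probability (A n) R)
    (mu : probability odometer_space R) :=
  forall n (B : forall i, set (A i)),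
    mu [set x | forall i, (i < n)%N -> B i (x i)] =
    (\prod_(i < n) mu_ i (B i))%E.

Definition max_mass n (mu_n : probability (A n) R) : R :=
  \big[Num.max/0]_(a : A n) fine (mu_n [set a]).

End odometer.

(* Main.v *)
Require Import Defs.
From HB Require Import structures.
From mathcomp Require Import all_boot all_order all_algebra.
From mathcomp Require Import all_classical all_reals all_analysis.
From mathcomp Require Import measurable_realfun zify ring lra.
From mathcomp.real_closed Require Import complex.

Set Implicit Arguments.
Unset Strict Implicit.
Unset Printing Implicit Defensive.

Import Order.TTheory GRing.Theory Num.Theory.
Import numFieldNormedType.Exports.

Local Open Scope classical_set_scope.
Local Open Scope ring_scope.

(** The digits below level [n], read in mixed radix, give a number [value n x]
    in [0, N) with [N = radix n], and the odometer increments this number modulo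
    [N] (Lemma [value_odometer]).  The level sets of [value n], here called
    cells, are the cylinders of depth [n]; the whole argument is about them.

    Periodic points.  A function of the first [n] digits is invariant under the
    [N]-th iterate of the odometer, so its class is a periodic point.  Cells form
    a pi-system generating the Borel sets, hence the functions of finitely many
    digits are dense in L^p: a Dynkin argument gives indicators of measurable
    sets, dominated convergence gives the rest
    (Lemma [power_approximable_of_finite]).

    Failure of the criterion for [p >= 2].  Write [Lp_power v] for the [p]-th
    power of the norm of [v].  Two estimates contradict each other.

    - Upper bound ([Lp_cotype]).  If a series is unconditionally convergent then
      its finite partial sums far enough out are bounded by 1, hence so are, by
      2, all signed ones.  For [p >= 2] Clarkson's inequality
      [2 (E u + E v) <= E (u + v) + E (u - v)], with [E = Lp_power], allows the
      signs of a finite sum to be chosen one by one so that [E] of the signed sum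
      is at least the sum of the [E (u i)].  So the sums of [Lp_power] over the
      orbits [T^m v] and [S^m v] are bounded.

    - Lower bound ([integral_le_shifts]).  When [i + m < N], the [m]-th iterate
      of the odometer maps the cell [C_i] onto [C_(i+m)] and changes only the
      first [n] digits, so it multiplies the product measure by the constant
      [mu C_(i+m) / mu C_i].  Hence, with [F = |v|^p], the integral of [|T^m v|^p]
      over [C_i] is [mu C_i / mu C_(i+m)] times that of [F] over [C_(i+m)], and,
      since [T^m (S^m v) = v], the integral of [|S^m v|^p] over [C_(i+m)] is
      [mu C_(i+m) / mu C_i] times that of [F] over [C_i].  Each ordered pair of
      cells thus contributes a term [mu C_i / mu C_j] times the integral of [F]
      over [C_j]; as the [mu C_i] add up to 1, the sum over [m < N] of
      [Lp_power (T^m v) + Lp_power (S^m v)] is at least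
      [Lp_power v / max_j mu C_j].

    The largest mass of a cell of depth [n] is at most the product of the first
    [n] maximal masses, which tends to 0; so [Lp_power v = 0] for every vector
    [v] of the dense set of the criterion, which is absurd. *)

(** * Unconditional convergence *)

(** If each tail of the index set has a distinguished finite nonempty set
    [F n], then some permutation of the integers lists infinitely many of these
    sets consecutively.  It is built by appending to a permutation of
    [0, ..., l - 1] the block [F l] and then the indices skipped below its
    maximum. *)
Section rearrangement.
Variable F : nat -> seq nat.
Hypothesis uniqF : forall n, uniq (F n).
Hypothesis geF : forall n, all (leq n) (F n).
Hypothesis F_neq0 : forall n, F n != [::].

Let fill n := [seq i <- iota n ((\max_(j <- F n) j).+1 - n) | i \notin F n].

Let stage k := iter k (fun L => L ++ F (size L) ++ fill (size L)) [::].

Let block_perm n :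
  perm_eq (F n ++ fill n) (iota n ((\max_(j <- F n) j).+1 - n)).
Proof.
apply: uniq_perm; rewrite ?iota_uniq//.
  rewrite cat_uniq uniqF filter_uniq ?iota_uniq// andbT /=.
  by apply/hasPn => i; rewrite mem_filter => /andP[].
move=> i; rewrite mem_cat mem_filter mem_iota.
have [iF|_] := boolP (i \in F n); last by [].
have ni : (n <= i)%N := allP (geF n) i iF.
have im : (i <= \max_(j <- F n) j)%N by exact: leq_bigmax_seq.
by rewrite /= ni subnKC ?ltnS ?im// (leq_trans ni)// ltnW.
Qed.

Let stage_perm k : perm_eq (stage k) (iota 0 (size (stage k))).
Proof.
elim: k => [//|k IH]; rewrite [stage _]/=.
rewrite size_cat iotaD perm_cat// add0n.
have := block_perm (size (stage k)).
by move=> H; have := perm_size H; rewrite size_iota => ->.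
Qed.

Let stageS_prefix j k : (j <= k)%N -> exists M, stage k = stage j ++ M.
Proof.
move=> /subnK <-; elim: (k - j)%N => [|d [M IH]]; first by exists [::]; rewrite cats0.
rewrite addSn [stage _]/= -/(stage _) IH.
by eexists; rewrite -catA; reflexivity.
Qed.

Let leq_size_stage k : (k <= size (stage k))%N.
Proof.
elim: k => [//|k IH]; rewrite [stage _]/= !size_cat.
have : (0 < size (F (size (stage k))))%N by rewrite lt0n size_eq0.
by move=> ?; rewrite -addn1 leq_add// (leq_trans _ (leq_addr _ _)).
Qed.

Let s i := nth 0%N (stage i.+1) i.

Let sE k i : (i < size (stage k))%N -> s i = nth 0%N (stage k) i.
Proof.
rewrite /s; have i1 := leq_size_stage i.+1.
have [/stageS_prefix[M ->] ik|/ltnW/stageS_prefix[M ->] _] := leqP k i.+1;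
  by rewrite nth_cat ?ik ?i1.
Qed.

Let stage_uniq k : uniq (stage k).
Proof. by rewrite (perm_uniq (stage_perm k)) iota_uniq. Qed.

Let s_inj : injective s.
Proof.
move=> i j; have im := leq_trans (leq_maxl i.+1 j.+1) (leq_size_stage _).
have jm := leq_trans (leq_maxr i.+1 j.+1) (leq_size_stage _).
by rewrite (sE im) (sE jm) => /eqP; rewrite nth_uniq// => /eqP.
Qed.

Lemma block_rearrangement : exists2 s : nat -> nat, bijective s &
  forall k, exists2 m, (k <= m)%N &
    exists2 n, (m <= n)%N & [seq s i | i <- iota m (n - m)] = F m.
Proof.
exists s.
  pose g j := index j (stage j.+1).
  have gK : cancel g s.
    move=> j; have jin : j \in stage j.+1.
      by rewrite (perm_mem (stage_perm _)) mem_iota/= leq_size_stage.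
    by rewrite (@sE j.+1) /g ?index_mem// nth_index.
  by exists g => // i; apply: s_inj; rewrite gK.
move=> k; exists (size (stage k)); first exact: leq_size_stage.
set m := size _; exists (m + size (F m))%N; first exact: leq_addr.
rewrite addKn; apply: (@eq_from_nth _ 0%N); first by rewrite size_map size_iota.
move=> i; rewrite size_map size_iota => iF.
rewrite (nth_map 0%N) ?size_iota// nth_iota//.
rewrite (@sE k.+1); last first.
  by rewrite [stage _]/= -/(stage k) !size_cat -/m ltn_add2l ltn_addr.
by rewrite [stage _]/= -/(stage k) !nth_cat -/m ltnNge leq_addr/= addKn iF.
Qed.

End rearrangement.

(** Otherwise every tail contains a finite set with a partial sum of norm
    greater than 1; listing infinitely many of these sets consecutively gives a
    rearrangement of the series that is not Cauchy. *)
Lemma unconditional_tail_le1 (K : numFieldType) (V : normedModType K) (u : V ^nat) :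
  unconditionally_convergent u ->
  exists n, forall F : seq nat, uniq F -> all (leq n) F ->
    `|\sum_(i <- F) u i| <= 1.
Proof.
move=> uc; apply: contrapT => /forallNP H.
have {}H n : exists F, [/\ uniq F, all (leq n) F & 1 < `|\sum_(i <- F) u i|].
  apply: contrapT => /forallNP nF; apply: (H n) => F Fu Fn.
  rewrite real_leNgt ?real1 ?normr_real//; apply/negP => F1.
  by apply: (nF F); split.
have [F HF] := choice H.
have F0 n : F n != [::].
  have [_ _] := HF n; case: (F n) => //.
  by rewrite big_nil normr0 ltr10.
have [s sbij sF] := block_rearrangement (fun n => let: And3 a _ _ := HF n in a)
  (fun n => let: And3 _ b _ := HF n in b) F0.
have /cvg_ex[l /cvgrPdist_lt/(_ (2^-1) _)] := uc s sbij.
rewrite invr_gt0 ltr0n => /(_ isT)[N _ HN].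
have [m Nm [n mn mF]] := sF N.
have [_ _] := HF m; apply/negP; rewrite -real_leNgt ?real1 ?normr_real//.
have -> : \sum_(i <- F m) u i = series (u \o s) n - series (u \o s) m.
  rewrite !/(series _ _) /series/= -mF big_map /index_iota.
  by rewrite (big_cat_nat (leq0n m) mn)/= addrAC subrr add0r.
rewrite (_ : _ - _ = (l - series (u \o s) m) - (l - series (u \o s) n)); last first.
  by rewrite opprB [RHS]addrC addrA subrK.
rewrite (le_trans (ler_normB _ _))// ltW// [ltRHS](splitr 1) div1r.
by rewrite ltrD// HN//= (leq_trans Nm).
Qed.

(** * Inequalities for powers and scalars *)

Section powR_inequalities.
Context {R : realType}.
Implicit Types s t q : R.

Lemma powR_superadditive q s t : 1 <= q -> 0 <= s -> 0 <= t ->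
  s `^ q + t `^ q <= (s + t) `^ q.
Proof.
move=> q1 s0 t0; have q0 : 0 < q by exact: lt_le_trans q1.
rewrite -(mulr_powRB1 s0 q0) -(mulr_powRB1 t0 q0) -(mulr_powRB1 (addr_ge0 s0 t0) q0).
by rewrite mulrDl lerD// ler_wpM2l// ge0_ler_powR ?subr_ge0 ?nnegrE ?addr_ge0//
  ?lerDl ?lerDr.
Qed.

Lemma powR_half_sum_le q s t : 1 <= q -> 0 <= s -> 0 <= t ->
  2 * ((s + t) / 2) `^ q <= s `^ q + t `^ q.
Proof.
move=> q1 s0 t0.
have h0 : (0 : R) <= 2^-1 by rewrite invr_ge0.
have h1 : (2^-1 : R) <= 1 by rewrite invf_le1 ?ler1n.
have := convex_powR q1 (Itv01 h0 h1) (x := s) (y := t).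
rewrite !inE/= !in_itv/= s0 t0 => /(_ isT isT).
rewrite [conv _ _ _]convRE [X in _ <= X]convRE /=.
rewrite (_ : unstable.onem 2^-1 = 2^-1); last first.
  by rewrite /unstable.onem {1}(splitr 1) div1r addrK.
by rewrite -!mulrDr => H; rewrite [(s + t) / 2]mulrC -ler_pdivlMl.
Qed.

(** A crude substitute for the triangle inequality: it keeps the approximation
    arguments in terms of integrals of [p]-th powers, without roots. *)
Lemma powR_sumr_le q s t : 0 <= q -> 0 <= s -> 0 <= t ->
  (s + t) `^ q <= 2 `^ q * (s `^ q + t `^ q).
Proof.
move=> q0; wlog st : s t / s <= t => [H s0 t0|s0 t0].
  have [/H|/ltW/H] := leP s t; first exact.
  by rewrite addrC [X in _ * X]addrC; exact.
rewrite (@le_trans _ _ ((2 * t) `^ q))//.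
  by rewrite ge0_ler_powR ?nnegrE ?addr_ge0 ?mulr_ge0// mulr_natl mulr2n lerD2r.
by rewrite powRM// ler_wpM2l ?powR_ge0// lerDr powR_ge0.
Qed.

End powR_inequalities.

Section scalar_inequalities.
Context {R : realType} {k : scalar_kind}.
Local Notation K := (scalars R k).
Implicit Types x y : K.

Lemma modulusN x : modulus (- x) = modulus x.
Proof. by rewrite /modulus normrN. Qed.

Lemma modulus_real_scalar (a : R) : modulus (real_scalar a : K) = `|a|.
Proof.
rewrite modulus_reim.
by case: k => /=; rewrite expr0n addr0 sqrtr_sqr.
Qed.

Lemma scalar_reN x : scalar_re (- x) = - scalar_re x.
Proof. by apply/eqP; rewrite -addr_eq0 -scalar_reD addNr scalar_re0. Qed.

Lemma scalar_imN x : scalar_im (- x) = - scalar_im x.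
Proof. by apply/eqP; rewrite -addr_eq0 -scalar_imD addNr scalar_im0. Qed.

Lemma modulus_parallelogram x y :
  modulus (x + y) ^+ 2 + modulus (x - y) ^+ 2 =
  2 * (modulus x ^+ 2 + modulus y ^+ 2).
Proof.
rewrite !modulus_reim !sqr_sqrtr ?addr_ge0 ?sqr_ge0//.
rewrite !scalar_reD !scalar_imD scalar_reN scalar_imN; ring.
Qed.

(** Convexity of the power [p / 2], then the parallelogram identity, then
    superadditivity of the same power. *)
Lemma modulus_clarkson p x y : 2 <= p ->
  2 * (modulus x `^ p + modulus y `^ p) <=
  modulus (x + y) `^ p + modulus (x - y) `^ p.
Proof.
move=> p2; have sqrE (z : K) : modulus z `^ p = (modulus z ^+ 2) `^ (p / 2).
  by rewrite -powR_mulrn ?modulus_ge0// -powRrM mulrC divfK.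
have q1 : 1 <= p / 2 by rewrite ler_pdivlMr// mul1r.
rewrite !sqrE; apply: le_trans (powR_half_sum_le q1 (sqr_ge0 _) (sqr_ge0 _)).
rewrite modulus_parallelogram.
rewrite (_ : 2 * _ / 2 = modulus x ^+ 2 + modulus y ^+ 2); last by rewrite mulrC mulKf.
by rewrite ler_wpM2l// powR_superadditive// sqr_ge0.
Qed.

End scalar_inequalities.

Section scalar_parts.
Context {R : realType} {k : scalar_kind}.
Local Notation K := (scalars R k).
Implicit Types x y : K.

Lemma scalar_re_real (a : R) : scalar_re (real_scalar a : K) = a.
Proof. by case: k. Qed.

Lemma scalar_im_real (a : R) : scalar_im (real_scalar a : K) = 0.
Proof. by case: k. Qed.

Lemma real_scalarN (a : R) : real_scalar (- a) = - real_scalar a :> K.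
Proof. by apply/eqP; rewrite -addr_eq0 -real_scalarD addNr real_scalar0. Qed.

Lemma scalar_re_le x : `|scalar_re x| <= modulus x.
Proof.
by rewrite modulus_reim -sqrtr_sqr ler_wsqrtr// lerDl sqr_ge0.
Qed.

Lemma scalar_im_le x : `|scalar_im x| <= modulus x.
Proof.
by rewrite modulus_reim -sqrtr_sqr ler_wsqrtr// lerDr sqr_ge0.
Qed.

(** The witness is the imaginary unit for complex scalars; for real ones, whose
    imaginary part is 0, any scalar would do. *)
Lemma scalar_decomposition : exists i : K, forall x,
  x = real_scalar (scalar_re x) + i * real_scalar (scalar_im x).
Proof.
case: k => /=; first by exists 0 => x; rewrite mul0r addr0.
by exists 'i%C => -[a b]; simpc.
Qed.

End scalar_parts.

(** * The p-th power of the norm and cotype p *)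

Section scalar_measurable_opp.
Context d (T : measurableType d) (R : realType) (k : scalar_kind).
Implicit Types phi psi : T -> scalars R k.

Lemma scalar_measurableN phi : scalar_measurable phi -> scalar_measurable (- phi).
Proof. by move=> mphi; rewrite -scaleN1r; exact: scalar_measurableZ. Qed.

Lemma scalar_measurableB phi psi : scalar_measurable phi -> scalar_measurable psi ->
  scalar_measurable (phi - psi).
Proof.
by move=> mphi mpsi; exact: scalar_measurableD mphi (scalar_measurableN mpsi).
Qed.

End scalar_measurable_opp.

Section power_integral.
Context d (T : measurableType d) (R : realType) (k : scalar_kind).
Variables (mu : {measure set T -> \bar R}) (p : R) (p1 : 1 <= p).
Local Notation K := (scalars R k).
Implicit Types phi psi : T -> K.

Let p0 : 0 < p. Proof. exact: lt_le_trans p1. Qed.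

Definition power_integral phi : \bar R := (\int[mu]_x (modulus (phi x) `^ p)%:E)%E.

Lemma power_integral_ge0 phi : (0 <= power_integral phi)%E.
Proof. by apply: integral_ge0 => x _; rewrite lee_fin powR_ge0. Qed.

Lemma measurable_modulus_powR phi : scalar_measurable phi ->
  measurable_fun setT (fun x => (modulus (phi x) `^ p)%:E).
Proof.
move=> mphi; apply/measurable_EFinP.
apply: (@measurableT_comp _ _ _ _ _ _ (@powR R ^~ p)) => //.
exact: measurable_modulus.
Qed.

Lemma scalar_Lnorm_power_integral phi :
  scalar_Lnorm mu p phi = (power_integral phi `^ p^-1)%E.
Proof.
rewrite /scalar_Lnorm unlock /=; congr poweR; apply: eq_integral => x _.
by rewrite ger0_norm// modulus_ge0.
Qed.

Lemma power_integral_Lnorm phi :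
  power_integral phi = (scalar_Lnorm mu p phi `^ p)%E.
Proof.
rewrite scalar_Lnorm_power_integral -poweRrM mulVf ?gt_eqF// poweRe1//.
exact: power_integral_ge0.
Qed.

Lemma power_integral_fin_num (phi : LpFun k mu p1) :
  power_integral phi \is a fin_num.
Proof.
by rewrite power_integral_Lnorm -[X in (X `^ _)%E]fineK ?LpFun_Lnorm_fin_num.
Qed.

Lemma power_integral_ae phi psi : scalar_measurable phi -> scalar_measurable psi ->
  {ae mu, forall x, phi x = psi x} -> power_integral phi = power_integral psi.
Proof.
move=> mphi mpsi ae_eq; apply: ae_eq_integral => //; try exact: measurable_modulus_powR.
by apply: filterS ae_eq => x ->.
Qed.

Lemma power_integral_clarkson phi psi : 2 <= p ->
  scalar_measurable phi -> scalar_measurable psi ->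
  (2%:E * (power_integral phi + power_integral psi) <=
   power_integral (phi + psi)%R + power_integral (phi - psi)%R)%E.
Proof.
move=> p2 mphi mpsi.
have mD := scalar_measurableD mphi mpsi.
have mB := scalar_measurableB mphi mpsi.
rewrite -!ge0_integralD//; try exact: measurable_modulus_powR;
  try by move=> x _; rewrite lee_fin powR_ge0.
have madd : measurable_fun setT
    (fun x => (modulus (phi x) `^ p)%:E + (modulus (psi x) `^ p)%:E)%E.
  by apply: emeasurable_funD; exact: measurable_modulus_powR.
rewrite -ge0_integralZl//; last first.
  by move=> x _; rewrite -EFinD lee_fin addr_ge0// powR_ge0.
apply: ge0_le_integral => //.
- by move=> x _; rewrite -EFinD -EFinM lee_fin mulr_ge0// addr_ge0// powR_ge0.
- exact: measurable_funeM.
- by apply: emeasurable_funD; exact: measurable_modulus_powR.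
- by move=> x _; rewrite -!EFinD -EFinM lee_fin modulus_clarkson.
Qed.

Lemma power_integralD phi psi :
  scalar_measurable phi -> scalar_measurable psi ->
  (power_integral (phi + psi)%R <=
   (2 `^ p)%:E * (power_integral phi + power_integral psi))%E.
Proof.
move=> mphi mpsi; have mD := scalar_measurableD mphi mpsi.
rewrite -!ge0_integralD//; try exact: measurable_modulus_powR;
  try by move=> x _; rewrite lee_fin powR_ge0.
have madd : measurable_fun setT
    (fun x => (modulus (phi x) `^ p)%:E + (modulus (psi x) `^ p)%:E)%E.
  by apply: emeasurable_funD; exact: measurable_modulus_powR.
rewrite -ge0_integralZl//; last first.
  by move=> x _; rewrite -EFinD lee_fin addr_ge0// powR_ge0.
apply: ge0_le_integral => //.
- by move=> x _; rewrite lee_fin powR_ge0.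
- exact: measurable_modulus_powR.
- exact: measurable_funeM.
- move=> x _; rewrite -EFinD -EFinM lee_fin.
  apply: le_trans (powR_sumr_le _ _ _) => //; rewrite ?modulus_ge0 ?(ltW p0)//.
  by rewrite ge0_ler_powR ?nnegrE ?addr_ge0 ?modulus_ge0 ?(ltW p0)// modulusD.
Qed.

Lemma power_integralN phi : power_integral (- phi) = power_integral phi.
Proof. by apply: eq_integral => x _; rewrite -modulusN opprK. Qed.

Lemma power_integralZ (a : K) phi : scalar_measurable phi ->
  power_integral (a *: phi) = ((modulus a `^ p)%:E * power_integral phi)%E.
Proof.
move=> mphi; have mphip := measurable_modulus_powR mphi.
rewrite -ge0_integralZl ?lee_fin ?powR_ge0//; last first.
  by move=> x _; rewrite lee_fin powR_ge0.
apply: eq_integral => x _; rewrite -EFinM -powRM ?modulus_ge0// -modulusM.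
by [].
Qed.

End power_integral.

Section sign_choice.
Context {R : realDomainType} {V : zmodType}.
Variable N : V -> R.
Hypothesis N_ge0 : forall v, 0 <= N v.
Hypothesis N_clarkson : forall u v, 2 * (N u + N v) <= N (u + v) + N (u - v).

(** The sign of each new term is the one for which the larger of [N (v + u a)]
    and [N (v - u a)] occurs; the hypothesis says that their mean is at least
    [N v + N (u a)].  The two lists hold the indices with sign plus and minus. *)
Lemma sign_choice (u : nat -> V) (F : seq nat) :
  exists F1 F2, perm_eq F (F1 ++ F2) /\
    \sum_(i <- F) N (u i) <= N (\sum_(i <- F1) u i - \sum_(i <- F2) u i).
Proof.
elim: F => [|a F [F1 [F2 [F12 le12]]]].
  by exists [::], [::]; split=> //; rewrite big_nil N_ge0.
set v := \sum_(i <- F1) _ - _ in le12.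
have := N_clarkson v (u a); rewrite big_cons.
have [le_add _|lt_add Hc] := leP (N (u a) + \sum_(i <- F) N (u i)) (N (v + u a)).
  exists (a :: F1), F2; split; first by rewrite perm_cons.
  by rewrite big_cons -addrA -/v [u a + v]addrC.
exists F1, (a :: F2); split.
  by rewrite perm_sym -(perm_catCA [:: a] F1 F2)/= perm_cons perm_sym.
rewrite big_cons opprD addrCA addrC -/v; lra.
Qed.

End sign_choice.

Section Lp_norm_power.
Context d (T : measurableType d) (R : realType) (k : scalar_kind).
Variables (mu : {measure set T -> \bar R}) (p : R) (p1 : 1 <= p).
Local Notation K := (scalars R k).
Local Notation Lp := (Lp k mu p1).

Let p0 : 0 < p. Proof. exact: lt_le_trans p1. Qed.

Definition Lp_power (v : Lp) : R := fine (power_integral mu p (repr v)).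

Lemma Lp_power_ge0 v : 0 <= Lp_power v.
Proof. by rewrite fine_ge0// power_integral_ge0. Qed.

Lemma Lp_power_repr v : (Lp_power v)%:E = power_integral mu p (repr v).
Proof. by rewrite fineK//; exact: power_integral_fin_num. Qed.

Lemma Lp_classB (f g : LpFun k mu p1) : Lp_class (f - g) = Lp_class f - Lp_class g.
Proof. by rewrite /Lp_class !piE. Qed.

Lemma Lp_power_class (f : LpFun k mu p1) :
  (Lp_power (Lp_class f))%:E = power_integral mu p f.
Proof.
rewrite Lp_power_repr.
apply: power_integral_ae; [exact: LpFun_measurable..|exact: Lp_repr_class].
Qed.

Lemma Lp_norm_powR (v : Lp) : `|v| = real_scalar (Lp_power v `^ p^-1).
Proof.
transitivity (Lp_norm v) => //; rewrite /Lp_norm scalar_Lnorm_power_integral//.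
by rewrite -[X in (X `^ _)%E]fineK ?(power_integral_fin_num (p1 := p1)).
Qed.

Lemma Lp_norm_le (v : Lp) (c : R) : 0 <= c ->
  (`|v| <= real_scalar c) = (Lp_power v <= c `^ p).
Proof.
move=> c0; rewrite Lp_norm_powR ler_real_scalar.
have {1}-> : c = (c `^ p) `^ p^-1 by rewrite -powRrM mulfV ?gt_eqF// powRr1.
have [H|H] := leP (Lp_power v) (c `^ p).
  by rewrite ge0_ler_powR ?nnegrE ?invr_ge0 ?(ltW p0)// ?Lp_power_ge0 ?powR_ge0.
apply/negbTE; rewrite -ltNge gt0_ltr_powR ?nnegrE ?invr_gt0//.
- exact: powR_ge0.
- exact: Lp_power_ge0.
Qed.

(** Transfers an inequality between extended reals to their finite values while
    keeping the classes in L^p abstract. *)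
Let fin_clarkson (a b c e : R) (A B C E : \bar R) :
  a%:E = A -> b%:E = B -> c%:E = C -> e%:E = E ->
  (2%:E * (A + B) <= C + E)%E -> 2 * (a + b) <= c + e.
Proof. by move=> <- <- <- <-. Qed.

Hypothesis p2 : 2 <= p.

Lemma Lp_power_clarkson (u v : Lp) :
  2 * (Lp_power u + Lp_power v) <= Lp_power (u + v) + Lp_power (u - v).
Proof.
have addE : (Lp_power (u + v))%:E = power_integral mu p (repr u + repr v)%R.
  by rewrite -{1}[u]Lp_classK -{1}[v]Lp_classK -Lp_classD; exact: Lp_power_class.
have subE : (Lp_power (u - v))%:E = power_integral mu p (repr u - repr v)%R.
  by rewrite -{1}[u]Lp_classK -{1}[v]Lp_classK -Lp_classB; exact: Lp_power_class.
apply: (fin_clarkson (Lp_power_repr u) (Lp_power_repr v) addE subE).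
exact: (power_integral_clarkson mu p2 (LpFun_measurable _) (LpFun_measurable _)).
Qed.

(** The space L^p has cotype [p] for [p >= 2], in the form needed here: signed
    sums of terms of large index have norm at most 2, so by the choice of signs
    the sum of the [p]-th powers of the norms of these terms is at most
    [2 `^ p]. *)
Lemma Lp_cotype (u : Lp ^nat) : unconditionally_convergent u ->
  exists M, forall m, \sum_(i < m) Lp_power (u i) <= M.
Proof.
move=> /unconditional_tail_le1[n Hn].
have tail_le F : uniq F -> all (leq n) F ->
    \sum_(i <- F) Lp_power (u i) <= 2 `^ p.
  move=> Fu Fn; have [F1 [F2 [F12 le12]]] := sign_choice Lp_power_ge0 Lp_power_clarkson u F.
  apply: le_trans le12 _; rewrite -Lp_norm_le//.
  have := Fu; rewrite (perm_uniq F12) cat_uniq => /and3P[u1 _ u2].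
  have := Fn; rewrite (perm_all _ F12) all_cat => /andP[n1 n2].
  rewrite (le_trans (ler_normB _ _))//.
  have -> : real_scalar 2 = 1 + 1 :> K.
    by rewrite -[2]/(1 + 1) real_scalarD; congr (_ + _); case: (k).
  by rewrite lerD// Hn.
exists (\sum_(i < n) Lp_power (u i) + 2 `^ p) => m.
rewrite -(big_mkord xpredT (fun i => Lp_power (u i))).
rewrite (@le_trans _ _ (\sum_(0 <= i < n + m) Lp_power (u i)))//.
  rewrite (@big_cat_nat _ _ _ m 0 (n + m))//= ?leq_addl//.
  by rewrite lerDl sumr_ge0// => i _; exact: Lp_power_ge0.
rewrite (@big_cat_nat _ _ _ n 0 (n + m))//= ?leq_addr// big_mkord lerD2l.
apply: tail_le; first exact: iota_uniq.
by apply/allP => i; rewrite mem_index_iota => /andP[].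
Qed.

End Lp_norm_power.

Section LpFun_construction.
Context d (T : measurableType d) (R : realType) (k : scalar_kind).
Variables (mu : {measure set T -> \bar R}) (p : R) (p1 : 1 <= p).

Lemma LpFunP (phi : T -> scalars R k) : scalar_measurable phi ->
  (power_integral mu p phi < +oo)%E -> {g : LpFun k mu p1 | g = phi :> (T -> _)}.
Proof.
move=> mphi phi_fin; suff phiL : phi \in scalar_Lfun mu p1 by exists (MkLpFun phiL).
rewrite inE /=; split=> //; rewrite scalar_Lnorm_power_integral//.
exact: poweR_lty.
Qed.

End LpFun_construction.

(** * Density in L^p of functions built on a generating pi-system *)

Section pi_system_density.
Context d (T : measurableType d) (R : realType) (k : scalar_kind).
Variables (mu : {finite_measure set T -> \bar R}) (p : R) (p1 : 1 <= p).
Local Notation K := (scalars R k).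
Implicit Types (phi psi : T -> K) (h : T -> R).

(* [G] is a generating pi-system and [D] a linear space of functions containing
   the indicators of its members. *)
Variable G : set (set T).
Hypothesis measurableG : @measurable _ T = <<s G >>.
Hypothesis setIG : setI_closed G.
Hypothesis GT : G setT.
Variable D : set (T -> K).
Hypothesis D_measurable : forall phi, D phi -> scalar_measurable phi.
Hypothesis DD : forall phi psi, D phi -> D psi -> D (phi + psi).
Hypothesis DZ : forall a phi, D phi -> D (a *: phi).
Hypothesis D_indic : forall A, G A -> D (real_scalar \o \1_A).

Let p0 : 0 < p. Proof. exact: lt_le_trans p1. Qed.

Local Notation pint := (power_integral mu p).

(** Membership in the closure of [D] in L^p, for functions rather than classes,
    so that pointwise limits make sense. *)
Definition power_approximable phi := scalar_measurable phi /\
  forall e : R, 0 < e -> exists2 psi, D psi & (pint (phi - psi)%R <= e%:E)%E.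

(* The constant [2 `^ p] is that of the quasi-triangle inequality
   [power_integralD]; half of [e] goes to each summand. *)
Let pintD_le phi psi (e : R) : scalar_measurable phi -> scalar_measurable psi ->
  (pint phi <= (e / (2 * 2 `^ p))%:E)%E -> (pint psi <= (e / (2 * 2 `^ p))%:E)%E ->
  (pint (phi + psi)%R <= e%:E)%E.
Proof.
move=> mphi mpsi le1 le2; apply: (le_trans (power_integralD mu p1 mphi mpsi)).
have P0 : 0 < 2 `^ p by rewrite powR_gt0.
apply: (@le_trans _ _ ((2 `^ p)%:E * ((e / (2 * 2 `^ p))%:E + (e / (2 * 2 `^ p))%:E))%E).
  by apply: lee_wpmul2l; [rewrite lee_fin ltW|exact: leeD le1 le2].
rewrite -EFinD -EFinM lee_fin le_eqVlt; apply/orP; left; apply/eqP.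
by field; rewrite gt_eqF.
Qed.

Let half_gt0 (e : R) : 0 < e -> 0 < e / (2 * 2 `^ p).
Proof. by move=> e0; rewrite divr_gt0// mulr_gt0// powR_gt0. Qed.

Lemma power_approximableD phi psi :
  power_approximable phi -> power_approximable psi ->
  power_approximable (phi + psi).
Proof.
move=> [mphi aphi] [mpsi apsi]; split; first exact: scalar_measurableD.
move=> e /half_gt0 e0; have [g Dg le_g] := aphi _ e0; have [h Dh le_h] := apsi _ e0.
exists (g + h); first exact: DD.
rewrite opprD addrACA.
exact: (pintD_le (scalar_measurableB mphi (D_measurable Dg))
  (scalar_measurableB mpsi (D_measurable Dh)) le_g le_h).
Qed.

Lemma power_approximableZ a phi :
  power_approximable phi -> power_approximable (a *: phi).
Proof.
move=> [mphi aphi]; split; first exact: scalar_measurableZ.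
move=> e e0; have c0 : 0 < modulus a `^ p + 1 by rewrite ltr_wpDl// powR_ge0.
have [g Dg le_g] := aphi _ (divr_gt0 e0 c0).
exists (a *: g); first exact: DZ.
have mB := scalar_measurableB mphi (D_measurable Dg).
rewrite -scalerBr power_integralZ//.
apply: (@le_trans _ _ ((modulus a `^ p)%:E * (e / (modulus a `^ p + 1))%:E)%E).
  by rewrite lee_wpmul2l// lee_fin powR_ge0.
by rewrite -EFinM lee_fin mulrCA ger_pMr// ler_pdivrMr// mul1r lerDl.
Qed.

Lemma power_approximable_sum (I : Type) (r : seq I) (phi : I -> T -> K) :
  power_approximable 0 -> (forall i, power_approximable (phi i)) ->
  power_approximable (\sum_(i <- r) phi i).
Proof.
move=> a0 aphi; elim: r => [|i r IH]; first by rewrite big_nil.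
by rewrite big_cons; exact: (power_approximableD (aphi i) IH).
Qed.

Let cvg_powR0 (u : nat -> R) : (forall n, 0 <= u n) -> u n @[n --> \oo] --> 0 ->
  u n `^ p @[n --> \oo] --> 0.
Proof.
move=> u0 cu; apply/cvgrPdist_le => e e0.
have e'0 : 0 < e `^ p^-1 by rewrite powR_gt0.
move/cvgrPdist_le/(_ _ e'0) : cu; apply: filterS => n.
rewrite !sub0r !normrN !ger0_norm ?powR_ge0// => le_un.
rewrite (le_trans (ge0_ler_powR (ltW p0) _ _ le_un)) ?nnegrE ?powR_ge0//.
by rewrite -powRrM mulVf ?gt_eqF// powRr1// ltW.
Qed.

(** Dominated convergence: the integrals of [|phi - phi_ n|^p] tend to 0. *)
Lemma power_approximable_lim phi (phi_ : nat -> T -> K) h :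
  scalar_measurable phi -> (forall n, power_approximable (phi_ n)) ->
  measurable_fun setT h -> (\int[mu]_x (h x `^ p)%:E < +oo)%E ->
  (forall n x, modulus (phi x - phi_ n x) <= h x) ->
  (forall x, modulus (phi x - phi_ n x) @[n --> \oo] --> 0) ->
  power_approximable phi.
Proof.
move=> mphi aphi_ mh hfin le_h cvg_phi; split=> // e /half_gt0 e0.
have mphi_ n := (aphi_ n).1.
have mB n := scalar_measurableB mphi (mphi_ n).
have h0 x : 0 <= h x by apply: le_trans (le_h 0%N x); exact: modulus_ge0.
have mhp : measurable_fun setT (fun x => (h x `^ p)%:E).
  apply/measurable_EFinP.
  exact: (@measurableT_comp _ _ _ _ _ _ (@powR R ^~ p)).
have [//| | | | |_ _] := @dominated_convergence _ _ _ mu setT measurableT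
  (fun n x => (modulus ((phi - phi_ n) x) `^ p)%:E) (cst 0%E)
  (fun x => (h x `^ p)%:E).
- by move=> n; exact: measurable_modulus_powR.
- exact: measurable_cst.
- apply: aeW => x _; apply: cvg_EFin; first exact: nearW.
  by apply: cvg_powR0 (cvg_phi x) => n; exact: modulus_ge0.
- apply/integrableP; split => //.
  by under eq_integral => x _ do rewrite gee0_abs ?lee_fin ?powR_ge0//.
- apply: aeW => x n _; rewrite gee0_abs ?lee_fin ?powR_ge0//.
  by rewrite ge0_ler_powR ?nnegrE ?modulus_ge0 ?(ltW p0)// le_h.
rewrite integral_cst// mul0e => cvg_int.
have [n le_n] : exists n, (pint (phi - phi_ n)%R <= (e / (2 * 2 `^ p))%:E)%E.
  have nbhs_lt : nbhs (0%E : \bar R) [set y | (y < (e / (2 * 2 `^ p))%:E)%E].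
    by apply: open_nbhs_nbhs; split; [exact: open_ereal_lt_ereal|rewrite /= lte_fin].
  have [N _ /(_ N (leqnn N)) HN] := cvg_int _ nbhs_lt; exists N.
  apply: le_trans (ltW HN); rewrite le_eqVlt; apply/orP; left; apply/eqP.
  by apply: eq_integral => x _.
have [psi Dpsi le_psi] := (aphi_ n).2 _ e0.
exists psi => //.
rewrite (_ : phi - psi = (phi - phi_ n) + (phi_ n - psi)); last by rewrite addrA subrK.
exact: (pintD_le (mB n) (scalar_measurableB (mphi_ n) (D_measurable Dpsi)) le_n le_psi).
Qed.

Let scalar_measurable_real h : measurable_fun setT h ->
  scalar_measurable (real_scalar \o h : T -> K).
Proof.
move=> mh; split.
  rewrite (_ : _ \o _ = h)//; apply/funext => x /=; exact: scalar_re_real.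
rewrite (_ : _ \o _ = cst 0)//; apply/funext => x /=; exact: scalar_im_real.
Qed.

Let power_approximableG A : G A -> power_approximable (real_scalar \o \1_A).
Proof.
move=> GA; have DA := D_indic GA; split; first exact: D_measurable.
move=> e e0; exists (real_scalar \o \1_A) => //.
rewrite subrr /power_integral.
under eq_integral => x _ do rewrite modulus0 powR0 ?gt_eqF//.
by rewrite integral0 lee_fin ltW.
Qed.

Let power_approximable0 : power_approximable 0.
Proof.
rewrite -(scale0r (real_scalar \o \1_setT)).
by apply: power_approximableZ; exact: power_approximableG.
Qed.

(** The measurable sets with approximable indicator form a Dynkin system: linear
    combinations handle complements and finite disjoint unions, and the partial
    unions converge to a countable one with differences bounded by 1. *)
Lemma power_approximable_indic A : measurable A ->
  power_approximable (real_scalar \o \1_A).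
Proof.
rewrite measurableG; move: A.
apply: (dynkin_induction measurableG setIG).
- exact: (power_approximableG GT).
- by move=> A GA; exact: (power_approximableG GA).
- move=> A mA aA.
  rewrite (_ : _ \o _ = (real_scalar \o \1_setT) + (-1) *: (real_scalar \o \1_A)).
    exact: (power_approximableD (power_approximableG GT) (power_approximableZ (-1) aA)).
  apply/funext => x.
  change (real_scalar (\1_(~` A) x) =
    real_scalar (\1_setT x) + -1 * real_scalar (\1_A x) :> K).
  rewrite indicT indicC indicE/=; case: (x \in A); rewrite /= ?real_scalar0.
    by rewrite mulN1r subrr.
  by rewrite mulr0 addr0.
- move=> F mF tF aF.
  have sumE n x : (\sum_(i < n) (real_scalar \o \1_(F i) : T -> K)) x =
      real_scalar (\1_(\bigcup_(i < n) F i) x).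
    elim: n => [|n IH]; first by rewrite big_ord0 II0 bigcup_set0 indic0 real_scalar0.
    rewrite big_ord_recr/=.
    transitivity (real_scalar (\1_(\bigcup_(i < n) F i) x) + real_scalar (\1_(F n) x) : K).
      by rewrite -IH.
    rewrite -real_scalarD; congr real_scalar; rewrite !indicE -natrD; congr (_%:R).
    have [xFn|xFn] := pselect (F n x).
      rewrite (mem_set xFn) memNset ?mem_set//; first by exists n => //=.
      move=> [m /= mn xFm]; suff mE : m = n by rewrite mE ltnn in mn.
      by apply: tF => //; exists x.
    rewrite (memNset xFn) addn0; congr nat_of_bool; apply/idP/idP; rewrite !inE.
      by move=> [m /= mn xFm]; exists m => //=; exact: ltnW.
    move=> [m /=]; rewrite ltnS leq_eqVlt => /predU1P[-> //|mn xFm].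
    by exists m.
  apply: (@power_approximable_lim _
    (fun n => \sum_(i < n) (real_scalar \o \1_(F i))) (cst 1)).
  + by apply: scalar_measurable_real; apply: measurable_indic; exact: bigcup_measurable.
  + move=> n; exact: (power_approximable_sum _ power_approximable0 (fun i : 'I_n => aF i)).
  + exact: measurable_cst.
  + under eq_integral => x _ do rewrite powR1.
    by rewrite integral_cst// mul1e; exact: fin_num_fun_lty.
  + move=> n x; rewrite sumE /= -real_scalarN -real_scalarD modulus_real_scalar !indicE.
    by case: (_ \in _); case: (_ \in _); rewrite ?subrr ?subr0 ?sub0r ?normrN ?normr1 ?normr0.
  + move=> x; apply: cvg_near_cst.
    have [[m _ xFm]|nx] := pselect ((\bigcup_i F i) x).
      exists m.+1 => // n /= mn; rewrite sumE /= -real_scalarN -real_scalarD.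
      rewrite modulus_real_scalar !indicE !mem_set ?subrr ?normr0//; first by exists m.
      by exists m.
    exists 0%N => // n _; rewrite sumE /= -real_scalarN -real_scalarD.
    rewrite modulus_real_scalar !indicE !memNset ?subrr ?normr0//.
    by move=> [m _ xFm]; apply: nx; exists m.
Qed.

Import HBNNSimple.

(** Monotone approximation by simple functions, dominated by [h] itself. *)
Lemma power_approximable_ge0 h : measurable_fun setT h -> (forall x, 0 <= h x) ->
  (\int[mu]_x (h x `^ p)%:E < +oo)%E -> power_approximable (real_scalar \o h).
Proof.
move=> mh h0 hfin.
have mEh : measurable_fun setT (EFin \o h) by exact/measurable_EFinP.
pose h_ := nnsfun_approx measurableT mEh.
have h_le n x : h_ n x <= h x.
  by rewrite -lee_fin /h_ nnsfun_approxE (le_approx n (f := EFin \o h))// => y _; rewrite lee_fin.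
apply: (@power_approximable_lim _ (fun n => real_scalar \o h_ n) h).
- exact: scalar_measurable_real mh.
- move=> n; rewrite (_ : _ \o _ = \sum_(y <- finmap.enum_fset (fset_set (range (h_ n))))
      real_scalar y *: (real_scalar \o \1_(h_ n @^-1` [set y]) : T -> K)).
    apply: (power_approximable_sum _ power_approximable0) => y.
    apply: power_approximableZ.
    apply: power_approximable_indic; rewrite -[X in measurable X]setTI.
    exact: measurable_funP.
  apply/funext => x; rewrite fct_sumE /= fimfunE fsbig_finite//=.
  rewrite (big_morph _ (@real_scalarD R k) (real_scalar0 R k)).
  by apply: eq_bigr => y _; rewrite real_scalarM.
- exact: mh.
- exact: hfin.
- move=> n x; rewrite /= -real_scalarN -real_scalarD modulus_real_scalar.
  by rewrite ger0_norm ?subr_ge0// gerBl; exact: fun_ge0.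
- move=> x; under eq_cvg => n do
    rewrite /= -real_scalarN -real_scalarD modulus_real_scalar.
  have /fine_cvgP[_ cvg_h] : EFin \o h_^~ x @ \oo --> (EFin \o h) x.
    by apply: cvg_nnsfun_approx => // y _; rewrite lee_fin.
  apply/cvgrPdist_le => e e0; move/cvgrPdist_le/(_ _ e0) : cvg_h.
  by apply: filterS => n /=; rewrite sub0r normrN normr_id.
Qed.

Lemma power_approximable_of_finite phi : scalar_measurable phi ->
  (pint phi < +oo)%E -> power_approximable phi.
Proof.
move=> mphi phifin.
have part h : measurable_fun setT h -> (forall x, `|h x| <= modulus (phi x)) ->
    power_approximable (real_scalar \o h).
  move=> mh hle.
  have fin (g : T -> R) : measurable_fun setT g -> (forall x, 0 <= g x <= `|h x|) ->
      power_approximable (real_scalar \o g).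
    move=> mg gh; apply: (power_approximable_ge0 mg).
      by move=> x; have /andP[] := gh x.
    apply: le_lt_trans phifin; apply: ge0_le_integral => //.
    - by move=> x _; rewrite lee_fin powR_ge0.
    - apply/measurable_EFinP.
      exact: (@measurableT_comp _ _ _ _ _ _ (@powR R ^~ p)).
    - exact: measurable_modulus_powR.
    - move=> x _; rewrite lee_fin; have /andP[g0 gle] := gh x.
      by rewrite ge0_ler_powR ?nnegrE ?modulus_ge0 ?(ltW p0)// (le_trans gle).
  have mmax (g : T -> R) : measurable_fun setT g ->
      measurable_fun setT (fun x => Num.max (g x) 0).
    by move=> mg; apply: measurable_maxr.
  rewrite (_ : _ \o h = (real_scalar \o (fun x => Num.max (h x) 0)) +
     (-1) *: (real_scalar \o (fun x => Num.max (- h x) 0))); last first.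
    apply/funext => x.
    change (real_scalar (h x) = real_scalar (Num.max (h x) 0) +
      -1 * real_scalar (Num.max (- h x) 0) :> K).
    rewrite mulN1r -real_scalarN -real_scalarD; congr real_scalar.
    by have [h0|h0] := leP (h x) 0; have [h1|h1] := leP (- h x) 0; lra.
  have absP (r : R) : 0 <= Num.max r 0 <= `|r|.
    by rewrite le_max lexx orbT/= ge_max ler_norm normr_ge0.
  apply: power_approximableD; last apply: power_approximableZ.
    by apply: fin; [exact: mmax|move=> x; exact: absP].
  apply: fin; first by apply: mmax; exact: measurableT_comp.
  by move=> x; rewrite -(normrN (h x)); exact: absP.
have [i iE] := @scalar_decomposition R k.
rewrite (_ : phi = (real_scalar \o (scalar_re \o phi)) +
    i *: (real_scalar \o (scalar_im \o phi))); last by apply/funext => x; exact: iE.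
have [mre mim] := mphi.
apply: power_approximableD; last apply: power_approximableZ.
  by apply: part => // x; exact: scalar_re_le.
by apply: part => // x; exact: scalar_im_le.
Qed.

End pi_system_density.

(** * Adding one with carry in mixed radix *)

Section odometer_digits.
Context (alpha : nat -> nat) (alpha2 : forall n, (2 <= alpha n)%N).
Local Notation X := (odometer_space alpha2).
Local Notation f := (@odometer alpha alpha2).
Implicit Types x y : X.

(** All digits below [n] are maximal, so that adding one carries into digit
    [n]. *)
Definition carry x n := all (fun j => x j == (alpha j).-1 :> nat) (iota 0 n).

Lemma carryS x n : carry x n.+1 = carry x n && (x n == (alpha n).-1 :> nat).
Proof. by rewrite /carry -addn1 iotaD all_cat /= add0n andbT. Qed.

Lemma carryP x n :
  reflect (forall j, (j < n)%N -> x j = (alpha j).-1 :> nat) (carry x n).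
Proof.
apply: (iffP allP) => [H j jn|H j]; last by rewrite mem_iota => /H/eqP.
by apply/eqP/H; rewrite mem_iota.
Qed.

Let ordS_last n (i : digit alpha2 n) :
  i = (alpha n).-1 :> nat -> ordS i = digit0 alpha2 n.
Proof.
move=> iE; apply: val_inj => /=; rewrite iE prednK ?modnn//.
exact: ltnW (alpha2 n).
Qed.

(** A description of the odometer without case distinction on the point with all
    digits maximal: its digits all receive a carry and wrap around to 0. *)
Lemma odometer_digit x n : f x n = if carry x n then ordS (x n) else x n.
Proof.
rewrite /odometer; case: pselect => [ex|nex]; last first.
  have xE j : x j = (alpha j).-1 :> nat.
    by apply/eqP; apply: contrapT => /negP nj; apply: nex; exists j.
  by rewrite ordS_last ?xE//; case: ifP => // /carryP[].
case: ex_minnP => l nl lmin.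
have lt_last j : (j < l)%N -> x j = (alpha j).-1 :> nat.
  move=> jl; apply/eqP; apply: contraTT jl => nj.
  by rewrite -leqNgt lmin.
case: ltngtP => [nltl|lltn|->].
- rewrite ifT ?ordS_last//; first exact: lt_last.
  by apply/carryP => j jn; apply: lt_last; exact: ltn_trans nltl.
- rewrite ifF//; apply/negP => /carryP/(_ _ lltn)/eqP.
  exact/negP.
- by rewrite ifT//; apply/carryP.
Qed.

Definition radix n := (\prod_(i < n) alpha i)%N.

Definition value n x := (\sum_(i < n) x i * radix i)%N.

Lemma radixS n : radix n.+1 = (radix n * alpha n)%N.
Proof. by rewrite /radix big_ord_recr. Qed.

Lemma valueS n x : value n.+1 x = (value n x + x n * radix n)%N.
Proof. by rewrite /value big_ord_recr. Qed.

Lemma radix_gt0 n : (0 < radix n)%N.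
Proof. by apply: prodn_gt0 => i; exact: ltnW (alpha2 i). Qed.

Lemma value_lt n x : (value n x < radix n)%N.
Proof.
elim: n => [|n IH]; first by rewrite /value /radix !big_ord0.
rewrite valueS radixS; have := ltn_ord (x n); nia.
Qed.

Lemma value_inj n x y : value n x = value n y ->
  forall i, (i < n)%N -> x i = y i.
Proof.
elim: n => [//|n IH]; rewrite !valueS => E.
have En : x n = y n :> nat.
  have := congr1 (fun m => m %/ radix n)%N E => /=.
  by rewrite !divnDMl ?radix_gt0// !divn_small ?value_lt.
have {}E : value n x = value n y by move: E; rewrite En => /addIn.
move=> i; rewrite ltnS leq_eqVlt => /predU1P[->|]; first exact: val_inj.
exact: IH.
Qed.

Lemma eq_value n x y : (forall i, (i < n)%N -> x i = y i) -> value n x = value n y.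
Proof. by move=> xy; apply: eq_bigr => i _; rewrite xy. Qed.

Lemma carry_value x n : carry x n = ((value n x).+1 == radix n).
Proof.
elim: n => [|n IH]; first by rewrite /value /radix !big_ord0.
rewrite carryS valueS radixS IH; have := ltn_ord (x n); have := value_lt n x.
have := alpha2 n; have := radix_gt0 n.
set r := radix n; set v := value n x; set a := alpha n; set d := nat_of_ord (x n).
move=> r0 a2 vr da; apply/andP/eqP => [[/eqP v1 /eqP d1]|H].
  by rewrite d1; nia.
have d1 : d = a.-1 by nia.
by split; apply/eqP; nia.
Qed.

Let value_odometer_carry n x : carry x n -> value n (f x) = 0%N.
Proof.
move=> /carryP c; rewrite /value big1// => i _; rewrite odometer_digit.
rewrite ifT; first by rewrite ordS_last ?c.
by apply/carryP => j ji; apply: c; exact: ltn_trans (ltn_ord i).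
Qed.

Lemma value_odometer n x : value n (f x) = ((value n x).+1 %% radix n)%N.
Proof.
have lt := value_lt n x.
have [c|c] := boolP (carry x n).
  by rewrite value_odometer_carry//; move: c; rewrite carry_value => /eqP ->; rewrite modnn.
have nc := c; rewrite carry_value in c.
rewrite modn_small; last by rewrite ltn_neqAle c.
elim: n nc {lt c} => [//|n IH]; rewrite carryS !valueS odometer_digit.
have [c|c] := boolP (carry x n) => /= H; last by rewrite IH// addSn.
have d1 : ((x n).+1 < alpha n)%N by have := ltn_ord (x n); lia.
rewrite modn_small// value_odometer_carry//.
move: c; rewrite carry_value => /eqP <-; rewrite mulSn; lia.
Qed.

Lemma value_iter_odometer n m x :
  value n (iter m f x) = ((value n x + m) %% radix n)%N.
Proof.
elim: m => [|m IH]; first by rewrite addn0 modn_small// value_lt.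
by rewrite iterS value_odometer IH -addn1 modnDml addn1 addnS.
Qed.

(** No carry leaves the first [n] digits as long as their value does not
    overflow. *)
Lemma iter_odometer_tail n m x i : (value n x + m < radix n)%N -> (n <= i)%N ->
  iter m f x i = x i.
Proof.
elim: m => [//|m IH] lt ni; rewrite iterS odometer_digit ifF ?IH//; first lia.
have lt' : (value n x + m < radix n)%N by lia.
apply/negP => /carryP c.
have : carry (iter m f x) n by apply/carryP => j jn; apply: c; lia.
by rewrite carry_value value_iter_odometer modn_small// => /eqP; lia.
Qed.

(** The orbit of the zero sequence provides a point with any prescribed value,
    without a digit extraction algorithm. *)
Definition digits_of m : X := iter m f (fun n => digit0 alpha2 n).

Lemma value_digits_of n m : (m < radix n)%N -> value n (digits_of m) = m.
Proof.
move=> mn; rewrite value_iter_odometer.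
have -> : value n (fun n => digit0 alpha2 n : digit alpha2 n) = 0%N.
  by rewrite /value big1.
by rewrite add0n modn_small.
Qed.

End odometer_digits.

(** * Cells generate the Borel sets *)

Section cylinders.
Context (alpha : nat -> nat) (alpha2 : forall n, (2 <= alpha n)%N).
Local Notation X := (odometer_space alpha2).
Implicit Types (x y : X) (A B : set X).

(** An implication suffices, as [x] and [y] may be exchanged. *)
Definition determined n A := forall x y, value n x = value n y -> A x -> A y.

Definition cell n j : set X := [set x | value n x = j].

Lemma measurable_digit i (a : digit alpha2 i) : measurable [set x : X | x i = a].
Proof.
apply: sub_sigma_algebra; rewrite /= openE => x /= <-.
exact: (@proj_continuous _ (fun n => digit alpha2 n : topologicalType) i x _
  (discrete_set1 (x i))).
Qed.

Lemma cellE n j : (j < radix alpha n)%N ->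
  cell n j = [set x | forall i, (i < n)%N -> x i = digits_of alpha2 j i].
Proof.
move=> jn; apply/seteqP; split=> [x xj|x xj]; rewrite /cell/=.
  by apply: value_inj; rewrite value_digits_of.
by rewrite (eq_value xj) value_digits_of.
Qed.

Lemma cell_eq0 n j : (radix alpha n <= j)%N -> cell n j = set0.
Proof.
move=> nj; apply/seteqP; split=> // x xj.
by have := value_lt n x; rewrite xj ltnNge nj.
Qed.

Lemma measurable_cell n j : measurable (cell n j).
Proof.
have [jn|nj] := ltnP j (radix alpha n).
  rewrite cellE// (_ : mkset _ = \bigcap_(i in `I_n) [set x : X | x i = digits_of alpha2 j i]).
    by apply: bigcap_measurableType => i _; exact: measurable_digit.
  by apply/seteqP; split.
by rewrite cell_eq0.
Qed.

Lemma determined_bigcup n A : determined n A ->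
  A = \bigcup_(j in [set j | (j < radix alpha n)%N /\ A (digits_of alpha2 j)]) cell n j.
Proof.
move=> dA; apply/seteqP; split=> [x Ax|x [j [jn Aj] xj]].
  exists (value n x) => //; split; first exact: value_lt.
  by apply: dA Ax; rewrite value_digits_of// value_lt.
by apply: dA Aj; rewrite value_digits_of.
Qed.

Lemma determined_measurable n A : determined n A -> measurable A.
Proof.
move=> /determined_bigcup ->; apply: bigcup_measurable => j _.
exact: measurable_cell.
Qed.

(** If no cell around [x] were contained in the open set [A], points outside [A]
    chosen in the cells of [x] would converge to [x], since each digit of these
    points is eventually that of [x]. *)
Lemma open_bigcup_determined A : @open (odometer_topological_space alpha2) A ->
  A = \bigcup_n [set x | forall y, value n x = value n y -> A y].
Proof.
move=> oA; apply/seteqP; split=> [x Ax|x [n _ /(_ x erefl)]//].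
apply: contrapT => /= nx.
have {}nx n : exists y, value n x = value n y /\ ~ A y.
  apply: contrapT => /forallNP ny; apply: nx; exists n => //= y xy.
  by apply: contrapT => nAy; apply: (ny y).
have [y Hy] := choice nx.
have : y @ \oo --> (x : odometer_topological_space alpha2).
  apply/cvg_sup => i U.
  rewrite (@nbhsE (initial_topology (@proj _ (fun n => digit alpha2 n) i))).
  move=> [W [[B oB <-] xB] sub]; exists i.+1 => // n /= ni.
  apply: sub; rewrite /= /proj -(value_inj (proj1 (Hy n)))//.
have nA : nbhs (x : odometer_topological_space alpha2) A by apply: open_nbhs_nbhs; split.
move=> /(_ _ nA)[N _ /(_ N (leqnn N))].
exact: (proj2 (Hy N)).
Qed.

(** The empty set is included to make the family stable under intersection. *)
Definition cells : set (set X) := [set A | A = set0 \/ exists n j, A = cell n j].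

Lemma measurable_cells : @measurable _ X = <<s cells >>.
Proof.
apply/seteqP; split.
  apply: smallest_sub; first exact: smallest_sigma_algebra.
  move=> A /open_bigcup_determined ->.
  apply: (@bigcup_measurable _ (g_sigma_algebraType cells)) => n _.
  have /determined_bigcup -> :
      determined n [set x | forall y, value n x = value n y -> A y].
    by move=> x y xy /= xA z; rewrite -xy; exact: xA.
  apply: (@bigcup_measurable _ (g_sigma_algebraType cells)) => j _.
  by apply: sub_sigma_algebra; right; exists n, j.
apply: smallest_sub; first exact: sigma_algebra_measurable.
by move=> A [->//|[n [j ->]]]; exact: measurable_cell.
Qed.

Lemma cells_setT : cells setT.
Proof.
right; exists 0%N, 0%N; apply/seteqP; split=> // x _.
by rewrite /cell/= /value big_ord0.
Qed.

(** Two cells are nested or disjoint. *)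
Lemma setI_closed_cells : setI_closed cells.
Proof.
move=> A B [->|[m [i ->]]]; first by left; rewrite set0I.
move=> [->|[n [j ->]]]; first by left; rewrite setI0.
wlog mn : m n i j / (m <= n)%N => [H|].
  by have [/H|/ltnW/H] := leqP m n => //; rewrite setIC.
have [->|/set0P[x [xi xj]]] := eqVneq (cell m i `&` cell n j) set0; first by left.
right; exists n, j; apply/seteqP; split=> [y []//|y yj]; split=> //.
rewrite -xi; apply: eq_value => k km.
by apply: (@value_inj _ _ n); rewrite ?(leq_trans km) ?xj ?yj.
Qed.

End cylinders.

(** * Iterates of the odometer rescale the measure *)

(** For fixed [i], the differences [j - i] with [i <= j] are distinct, and so are
    the differences [i - j] with [j < i]. *)
Lemma sum_two_sided_le (R : realType) (G H : nat -> \bar R) N i :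
  (forall m, 0 <= G m)%E -> (forall m, 0 <= H m)%E -> (i < N)%N ->
  (\sum_(j < N) (if (i <= j)%N then G (j - i)%N else H (i - j)%N) <=
   \sum_(m < N) (G m + H m))%E.
Proof.
move=> G0 H0 iN; rewrite big_split/=.
have [e NE] : exists e, N = (i + e)%N by exists (N - i)%N; rewrite subnKC// ltnW.
move: iN; rewrite {}NE => iN.
have -> : (\sum_(j < i + e) (if (i <= j)%N then G (j - i)%N else H (i - j)%N) =
    \sum_(m < i) H m.+1 + \sum_(m < e) G m)%E.
  rewrite big_split_ord/=; congr (_ + _)%E.
    rewrite (reindex_inj rev_ord_inj)/=; apply: eq_bigr => j _.
    by rewrite leqNgt ifF ?subKn//; apply/negbTE; rewrite negbK; have := ltn_ord j; lia.
  by apply: eq_bigr => j _; rewrite leq_addr addKn.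
rewrite addeC leeD//; first exact: (lee_sum_nneg_ord G xpredT (fun m _ => G0 m) _ _ (leq_addl i e)).
apply: (@le_trans _ _ (\sum_(m < i.+1) H m)%E); last first.
  exact: (lee_sum_nneg_ord H xpredT (fun m _ => H0 m) _ _ iN).
by rewrite big_ord_recl leeDr.
Qed.

Section odometer_shift.
Context (alpha : nat -> nat) (alpha2 : forall n, (2 <= alpha n)%N) (R : realType).
Local Notation X := (odometer_space alpha2).
Local Notation f := (@odometer alpha alpha2).
Local Notation radix := (radix alpha).
Variables (mu_ : forall n, probability (digit alpha2 n) R) (mu : probability X R).
Hypothesis mu_product : is_product_measure mu_ mu.
Implicit Types (x y : X).

Lemma measurable_iter_odometer m : measurable_fun setT (iter m f : X -> X).
Proof.
apply: (measurability (@cells _ alpha2) (measurable_cells alpha2)) => _ [B [->|[n [j ->]]] <-].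
  by rewrite preimage_set0 setI0.
rewrite setTI; apply: (@determined_measurable _ _ n) => x y xy.
by rewrite /= /cell/= !value_iter_odometer xy.
Qed.

(** Since the iterate acts as a rotation on the values, the preimage of a cell is
    a single cell, so that integrals over cells can be transported. *)
Lemma preimage_iter_odometer_cell n i m : (i + m < radix n)%N ->
  iter m f @^-1` cell n (i + m) = cell n i.
Proof.
move=> imn; apply/seteqP; split=> x; rewrite /cell/= value_iter_odometer.
  have xn := value_lt n x; case: (ltnP (value n x + m) (radix n)) => le.
    by rewrite modn_small// => /addIn.
  rewrite -(subnK le) modnDr modn_small; lia.
by move=> ->; rewrite modn_small.
Qed.

(** The bound [M] lets several cells of different depths be written as
    rectangles with the same number of sides. *)
Lemma cell_prod n M j : (n <= M)%N -> (j < radix n)%N ->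
  mu (cell n j) = (\prod_(q < M) mu_ q
    (if (q < n)%N then [set digits_of alpha2 j q] else setT))%E.
Proof.
move=> nM jn; rewrite -(@mu_product M (fun q =>
  if (q < n)%N then [set digits_of alpha2 j q] else setT)).
rewrite cellE//; congr (mu _); apply/seteqP; split=> x /= H q.
  by move=> qM; case: ifPn => // /H.
by move=> qn; have := H q (leq_trans qn nM); rewrite qn.
Qed.

(** On the cell [i] the iterate replaces the first [n] digits by those of
    [i + m] and keeps the others, so the intersection is a rectangle, empty as
    soon as the cell [l, c] disagrees with the cell [n, i + m]. *)
Lemma cell_shift_prod n M i m l c : (n <= M)%N -> (l <= M)%N ->
  (i + m < radix n)%N -> (c < radix l)%N ->
  mu (cell n i `&` iter m f @^-1` cell l c) = (\prod_(q < M) mu_ q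
    (if (q < n)%N then
       if (q < l)%N && (digits_of alpha2 c q != digits_of alpha2 (i + m) q)
       then set0 else [set digits_of alpha2 i q]
     else if (q < l)%N then [set digits_of alpha2 c q] else setT))%E.
Proof.
move=> nM lM imn cl; rewrite -(@mu_product M (fun q => if (q < n)%N then
       if (q < l)%N && (digits_of alpha2 c q != digits_of alpha2 (i + m) q)
       then set0 else [set digits_of alpha2 i q]
     else if (q < l)%N then [set digits_of alpha2 c q] else setT)).
have iN : (i < radix n)%N by lia.
have shift x q : cell n i x -> iter m f x q =
    if (q < n)%N then digits_of alpha2 (i + m) q else x q.
  move=> xi; case: ltnP => qn.
    apply: (@value_inj _ _ n) => //; rewrite value_digits_of//.
    by rewrite value_iter_odometer xi modn_small.
  by apply: (@iter_odometer_tail _ _ n) => //; rewrite xi.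
rewrite !cellE// -cellE//; congr (mu _); apply/seteqP; split=> x /=.
  move=> [xi xc] q qM; case: ifPn => qn.
    rewrite ifF; first by move: (xi); rewrite cellE// => /(_ q qn).
    apply/negbTE; rewrite negb_and negbK; case: ltnP => //= ql.
    by rewrite -xc// shift// qn.
  by case: ifPn => // ql; rewrite -xc// shift// (negbTE qn).
move=> H; have xi : cell n i x.
  rewrite cellE// => q qn; have := H q (leq_trans qn nM).
  by rewrite qn; case: ifP.
split=> // q ql; rewrite shift//; have := H q (leq_trans ql lM).
rewrite ql /=; case: ifPn => // qn.
by case: ifPn => // /negbNE/eqP ->.
Qed.

(** Both sides are finite measures in [E].  On cells they are products that agree
    factor by factor: below [n] they exchange the masses of the digits of [i] and
    of [i + m], above [n] they have the same factors. *)
Lemma mu_cell_shift n i m (E : set X) : (i + m < radix n)%N -> measurable E ->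
  (mu (cell n (i + m)) * mu (cell n i `&` iter m f @^-1` E) =
   mu (cell n i) * mu (cell n (i + m) `&` E))%E.
Proof.
move=> imn; have iN : (i < radix n)%N by lia.
have r1 : 0 <= fine (mu (cell n (i + m))) by rewrite fine_ge0.
have r2 : 0 <= fine (mu (cell n i)) by rewrite fine_ge0.
pose fm : X -> X := iter m f.
have mfm : measurable_fun setT fm := measurable_iter_odometer m.
pose m1_ : {measure set X -> \bar R} := mscale (NngNum r1)
  (pushforward (mrestr mu (measurable_cell n i)) fm).
pose m1 := m1_ mfm.
pose m2 : {measure set X -> \bar R} := mscale (NngNum r2)
  (mrestr mu (measurable_cell n (i + m))).
have m1E A : m1 A = (mu (cell n (i + m)) * mu (cell n i `&` iter m f @^-1` A))%E.
  rewrite /m1 /m1_/= /mscale/= /pushforward /mrestr setIC fineK//.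
  exact: fin_num_measure (measurable_cell n (i + m)).
have m2E A : m2 A = (mu (cell n i) * mu (cell n (i + m) `&` A))%E.
  rewrite /m2/= /mscale/= /mrestr setIC fineK//.
  exact: fin_num_measure (measurable_cell n i).
move=> mE; rewrite -m1E -m2E.
apply: (measure_unique (@cells _ alpha2) (fun=> setT)) => //.
- exact: measurable_cells.
- exact: setI_closed_cells.
- by move=> k; exact: cells_setT.
- exact: bigcup_const.
- move=> _ [->|[l [c ->]]]; first by rewrite !measure0.
  rewrite m1E m2E.
  have [cl|lc] := ltnP c (radix l); last first.
    by rewrite (cell_eq0 _ lc) preimage_set0 !setI0 !measure0 !mule0.
  have nM : (n <= maxn n l)%N by exact: leq_maxl.
  have lM : (l <= maxn n l)%N by exact: leq_maxr.
  (* The right-hand side is handled by the same product formula, for a shift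
     by 0. *)
  have im0 : (i + m + 0 < radix n)%N by rewrite addn0.
  rewrite (cell_prod nM imn) (cell_prod nM iN) (cell_shift_prod nM lM imn cl).
  rewrite -[X in (_ * mu (_ `&` X))%E](preimage_id) -[@id X]/(iter 0 f).
  rewrite (cell_shift_prod nM lM im0 cl) -!big_split/=.
  apply: eq_bigr => q _; rewrite addn0; case: ifPn => // qn.
  by case: ifPn => _; rewrite ?measure0 ?mule0// muleC.
- move=> k; rewrite m1E; apply: lte_mul_pinfty => //.
    exact: fin_num_measure (measurable_cell n (i + m)).
  have mI : measurable (cell n i `&` iter m f @^-1` setT).
    by rewrite preimage_setT setIT; exact: measurable_cell.
  by rewrite (le_lt_trans (probability_le1 _ mI))// ltry.
Qed.

Lemma integral_cell_shift n i m (F : X -> \bar R) : (i + m < radix n)%N ->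
  measurable_fun setT F -> (forall x, (0 <= F x)%E) ->
  (mu (cell n (i + m)) * \int[mu]_(x in cell n i) F (iter m f x) =
   mu (cell n i) * \int[mu]_(x in cell n (i + m)) F x)%E.
Proof.
move=> imn mF F0.
have r1 : 0 <= fine (mu (cell n (i + m))) by rewrite fine_ge0.
have r2 : 0 <= fine (mu (cell n i)) by rewrite fine_ge0.
pose fm : X -> X := iter m f.
have mfm : measurable_fun setT fm := measurable_iter_odometer m.
have mcell k : measurable (cell n k) := measurable_cell n k.
have fin k : mu (cell n k) = (fine (mu (cell n k)))%:E.
  by rewrite fineK//; exact: fin_num_measure.
have -> : (\int[mu]_(x in cell n i) F (iter m f x) =
    \int[pushforward mu fm]_(x in cell n (i + m)) F x)%E.
  rewrite (ge0_integral_pushforward mfm) ?preimage_iter_odometer_cell//.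
  exact: measurable_funTS.
pose nu_ : {measure set X -> \bar R} := pushforward mu fm.
pose nu := nu_ mfm.
rewrite fin [in RHS]fin.
rewrite -[LHS](@ge0_integral_mscale _ _ _ nu _ _ (NngNum r1))//; last exact: measurable_funTS.
rewrite -[RHS](@ge0_integral_mscale _ _ _ mu _ _ (NngNum r2))//; last exact: measurable_funTS.
apply: eq_measure_integral => A mA Aj.
change ((fine (mu (cell n (i + m))))%:E * mu (fm @^-1` A) =
  (fine (mu (cell n i)))%:E * mu A)%E; rewrite -!fin.
have := mu_cell_shift imn mA.
rewrite (setIidr Aj) (setIidr)// -(preimage_iter_odometer_cell imn).
exact: preimage_subset.
Qed.

End odometer_shift.

Section odometer_measure.
Context (alpha : nat -> nat) (alpha2 : forall n, (2 <= alpha n)%N) (R : realType).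
Local Notation X := (odometer_space alpha2).
Local Notation f := (@odometer alpha alpha2).
Local Notation radix := (radix alpha).
Variables (mu_ : forall n, probability (digit alpha2 n) R) (mu : probability X R).
Hypothesis mu_product : is_product_measure mu_ mu.

Lemma max_mass_ge0 n : 0 <= max_mass (mu_ n).
Proof.
rewrite /max_mass; elim/big_ind : _ => // [x y x0 y0|a _]; first by rewrite le_max x0.
by rewrite fine_ge0.
Qed.

Lemma mu_cell_le n j : (j < radix n)%N ->
  (mu (cell n j) <= (\prod_(i < n) max_mass (mu_ i))%:E)%E.
Proof.
move=> jn; rewrite (cell_prod mu_product (leqnn n) jn).
rewrite (eq_bigr (fun q : 'I_n => (fine (mu_ q [set digits_of alpha2 j q]))%:E)); last first.
  by move=> q _; rewrite ltn_ord fineK//; exact: fin_num_measure.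
rewrite prodEFin lee_fin; apply: ler_prod => q _; rewrite fine_ge0//=.
by rewrite /max_mass le_bigmax.
Qed.

Lemma integral_cells n (F : X -> \bar R) :
  measurable_fun setT F -> (forall x, (0 <= F x)%E) ->
  (\int[mu]_x F x = \sum_(j < radix n) \int[mu]_(x in cell n j) F x)%E.
Proof.
move=> mF F0; have cellsT : \big[setU/set0]_(j < radix n) cell n j = setT :> set X.
  apply/seteqP; split=> // x _; rewrite -bigcup_mkord.
  by exists (value n x) => //; exact: value_lt.
rewrite -[in LHS]cellsT -(big_mkord xpredT) ge0_integral_bigsetU ?big_mkord//.
- by move=> j; exact: measurable_cell.
- exact: iota_uniq.
- by move=> i j _ _ [x [<- <-]].
- exact: measurable_funTS.
Qed.

(** The lower bound.  By [integral_cell_shift], for cells [i] and [j] the number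
    [mu C_i] times the integral of [F] over [C_j] equals [mu C_j] times the
    integral over [C_i] of the forward shift [F \o f^(j - i)] if [i <= j], of the
    backward shift [S (i - j)] otherwise.  It remains to bound [mu C_j] by [A] and
    to sum over [i] and [j].  This form avoids dividing by masses of cells. *)
Lemma integral_le_shifts n (A : R) (F : X -> \bar R) (S : nat -> X -> \bar R) :
  (forall j, (j < radix n)%N -> (mu (cell n j) <= A%:E)%E) ->
  measurable_fun setT F -> (forall x, (0 <= F x)%E) ->
  (forall m, measurable_fun setT (S m)) -> (forall m x, (0 <= S m x)%E) ->
  (forall m, {ae mu, forall x, S m (iter m f x) = F x}) ->
  (\int[mu]_x F x <= A%:E * \sum_(m < radix n)
    (\int[mu]_x F (iter m f x) + \int[mu]_x S m x))%E.
Proof.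
move=> muA mF F0 mS S0 SF.
have mFf m : measurable_fun setT (fun x => F (iter m f x)).
  by apply: measurableT_comp => //; exact: measurable_iter_odometer.
pose t i m := (\int[mu]_(x in cell n i) F (iter m f x))%E.
pose s i m := (\int[mu]_(x in cell n i) S m x)%E.
have t0 i m : (0 <= t i m)%E by apply: integral_ge0.
have s0 i m : (0 <= s i m)%E by apply: integral_ge0.
have A0 : (0 <= A%:E)%E by apply: le_trans (muA 0%N (radix_gt0 alpha2 n)).
have key (i j : 'I_(radix n)) :
    (mu (cell n i) * \int[mu]_(x in cell n j) F x <=
     A%:E * (if (i <= j)%N then t i (j - i)%N else s i (i - j)%N))%E.
  case: leqP => [ij|/ltnW ij].
    have ijn : (i + (j - i) < radix n)%N by rewrite subnKC.
    have := integral_cell_shift mu_product ijn mF F0.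
    by rewrite subnKC// => <-; rewrite lee_wpmul2r ?muA ?integral_ge0.
  have ijn : (j + (i - j) < radix n)%N by rewrite subnKC.
  have := integral_cell_shift mu_product ijn (mS (i - j)%N) (S0 (i - j)%N).
  rewrite subnKC// => E.
  rewrite (_ : \int[mu]_(x in cell n j) F x =
    \int[mu]_(x in cell n j) S (i - j)%N (iter (i - j)%N f x))%E; last first.
    apply: ae_eq_integral; first exact: measurable_cell.
    - exact: measurable_funTS.
    - apply: measurable_funTS; apply: measurableT_comp => //.
      exact: measurable_iter_odometer.
    - by apply: filterS (SF (i - j)%N) => x ->.
  by rewrite E lee_wpmul2r ?muA ?integral_ge0.
have muC1 : (\sum_(i < radix n) mu (cell n i) = 1)%E.
  rewrite -(probability_setT mu) -[RHS]mul1e -integral_cst//.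
  rewrite (integral_cells n)//; apply: eq_bigr => i _.
  by rewrite integral_cst ?mul1e//; exact: measurable_cell.
rewrite [leLHS](_ : _ = \sum_(i < radix n) \sum_(j < radix n)
    mu (cell n i) * \int[mu]_(x in cell n j) F x)%E; last first.
  rewrite (integral_cells n mF F0) -[LHS]mul1e -muC1 ge0_sume_distrl//.
  apply: eq_bigr => i _; rewrite ge0_sume_distrr// => j _.
  exact: integral_ge0.
apply: (@le_trans _ _ (\sum_(i < radix n) A%:E * \sum_(m < radix n) (t i m + s i m)))%E.
  apply: lee_sum => i _.
  apply: (@le_trans _ _ (\sum_(j < radix n) (A%:E *
    (if (i <= j)%N then t i (j - i)%N else s i (i - j)%N)))%E).
    by apply: lee_sum => j _; exact: key.
  rewrite -ge0_sume_distrr; last by move=> j _; case: ifP.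
  by rewrite lee_wpmul2l// sum_two_sided_le.
rewrite -ge0_sume_distrr; last by move=> i _; rewrite sume_ge0// => m _; rewrite adde_ge0.
rewrite lee_wpmul2l// exchange_big/=; apply: lee_sum => m _.
by rewrite big_split/= -!integral_cells.
Qed.

End odometer_measure.

(** * The composition operator of the odometer *)

(** The ball of radius [`|w|] around [w] misses 0. *)
Lemma dense_neq0 (K : numFieldType) (V : normedModType K) (V0 : set V) (w : V) :
  dense V0 -> w != 0 -> exists v, v != 0 /\ V0 v.
Proof.
move=> dV0; rewrite -normr_gt0 => w0.
have ob : open (ball w `|w|) by exact: ball_open.
have [v [wv V0v]] := dV0 (ball w `|w|) (ex_intro _ w (ballxx w w0)) ob.
exists v; split=> //; apply/eqP => v0; move: wv.
by rewrite -ball_normE /ball_/= v0 subr0 ltxx.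
Qed.

Section digit_functions.
Context (alpha : nat -> nat) (alpha2 : forall n, (2 <= alpha n)%N).
Context (R : realType) (k : scalar_kind).
Local Notation X := (odometer_space alpha2).
Local Notation K := (scalars R k).

Definition digit_function : set (X -> K) :=
  [set phi | exists n, forall x y, value n x = value n y -> phi x = phi y].

Lemma digit_function_measurable phi : digit_function phi -> scalar_measurable phi.
Proof.
move=> [n phin]; split=> _ Y mY; rewrite setTI; apply: (@determined_measurable _ _ n);
  by move=> x y xy /=; rewrite (phin _ _ xy).
Qed.

Lemma digit_functionD phi psi :
  digit_function phi -> digit_function psi -> digit_function (phi + psi).
Proof.
move=> [m phim] [n psin]; exists (maxn m n) => x y xy.
have agree l : (l <= maxn m n)%N -> value l x = value l y.
  move=> lmn; apply: eq_value => i il.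
  exact: (value_inj xy (leq_trans il lmn)).
by change (phi x + psi x = phi y + psi y);
  rewrite (phim x y) ?(psin x y)// agree ?leq_maxl ?leq_maxr.
Qed.

Lemma digit_functionZ a phi : digit_function phi -> digit_function (a *: phi).
Proof.
move=> [n phin]; exists n => x y xy.
by change (a * phi x = a * phi y); rewrite (phin x y).
Qed.

Lemma digit_function_cells A : cells A -> digit_function (real_scalar \o \1_A).
Proof.
move=> [->|[n [j ->]]]; first by exists 0%N => x y _ /=; rewrite indic0.
by exists n => x y xy /=; rewrite !indicE; congr real_scalar; congr (_%:R);
  congr nat_of_bool; apply/idP/idP; rewrite !inE /cell/= xy.
Qed.

End digit_functions.

Section odometer_operator.
Context (R : realType) (k : scalar_kind) (p : R) (p1 : 1 <= p)
    (alpha : nat -> nat) (alpha2 : forall n, (2 <= alpha n)%N)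
    (mu_ : forall n, probability (digit alpha2 n) R)
    (mu : probability (odometer_space alpha2) R)
    (mu_product : is_product_measure mu_ mu)
    (mu_max : \prod_(i < n) max_mass (mu_ i) @[n --> \oo] --> 0)
    (Tf : Lp k mu p1 -> Lp k mu p1)
    (Tf_comp : is_composition_operator (@odometer alpha alpha2) Tf).
Local Notation f := (@odometer alpha alpha2).
Local Notation K := (scalars R k).

Lemma iter_composition_operator m (phi : LpFun k mu p1) :
  exists2 psi : LpFun k mu p1, (forall x, psi x = phi (iter m f x)) &
    iter m Tf (Lp_class phi) = Lp_class psi.
Proof.
elim: m => [|m [psi psiE Tpsi]]; first by exists phi.
have [chi chiE Tchi] := Tf_comp psi; exists chi; last by rewrite iterS Tpsi.
by move=> x; rewrite chiE /= psiE -iterSr.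
Qed.

(** Iterating [radix alpha n] times adds 0 to [value n] modulo [radix alpha n]. *)
Lemma digit_function_periodic (phi : LpFun k mu p1) :
  digit_function phi -> periodic_points Tf (Lp_class phi).
Proof.
move=> [n phin]; exists (radix alpha n); first exact: radix_gt0.
have [psi psiE ->] := iter_composition_operator (radix alpha n) phi.
apply/Lp_classP; apply: aeW => x; rewrite psiE; apply: phin.
by rewrite value_iter_odometer modnDr modn_small// value_lt.
Qed.

Lemma digit_function_dense (phi : LpFun k mu p1) (e : R) : 0 < e ->
  exists2 g : LpFun k mu p1, digit_function g & Lp_power (Lp_class phi - Lp_class g) <= e.
Proof.
move=> e0; have mphi := LpFun_measurable phi.
have phi_fin : (power_integral mu p phi < +oo)%E.
  by rewrite -Lp_power_class ltry.
have [_ /(_ e e0)[g Dg le_g]] := power_approximable_of_finite p1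
  (measurable_cells alpha2) (@setI_closed_cells _ alpha2) (cells_setT alpha2)
  (@digit_function_measurable _ alpha2 R k) (@digit_functionD _ alpha2 R k)
  (@digit_functionZ _ alpha2 R k) (@digit_function_cells _ alpha2 R k) mphi phi_fin.
have mg := digit_function_measurable Dg.
have gfin : (power_integral mu p g < +oo)%E.
  pose phi0 : odometer_space alpha2 -> K := phi.
  have mB := scalar_measurableN (scalar_measurableB (mphi : scalar_measurable phi0) mg).
  have -> : g = phi0 + - (phi0 - g) by rewrite opprB addrC subrK.
  apply: (le_lt_trans (power_integralD mu p1 mphi mB)).
  apply: lte_mul_pinfty; rewrite ?lee_fin ?powR_ge0//.
  apply: lte_add_pinfty; first exact: phi_fin.
  by rewrite power_integralN; exact: (le_lt_trans le_g (ltry e)).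
have [G GE] := LpFunP p1 mg gfin.
exists G; first by rewrite GE.
rewrite -Lp_classB -lee_fin Lp_power_class.
by rewrite -GE in le_g; exact: le_g.
Qed.

Lemma periodic_points_dense : dense (periodic_points Tf).
Proof.
move=> W [v Wv] oW; have /nbhs_ballP[e e0 eW] : nbhs v W by apply: open_nbhs_nbhs; split.
pose c := modulus e.
have cE : real_scalar c = e by rewrite real_scalar_modulus gtr0_norm.
have c0 : 0 < c.
  rewrite lt_neqAle modulus_ge0 andbT eq_sym; apply/eqP => /modulus_eq0 e0'.
  by move: e0; rewrite /= e0' ltxx.
have c20 : 0 < c / 2 by rewrite divr_gt0.
have [g Dg le_g] := digit_function_dense (repr v) (powR_gt0 p c20).
exists (Lp_class g); split; last exact: digit_function_periodic.
apply: eW; rewrite -ball_normE /ball_/=.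
rewrite Lp_classK -Lp_norm_le ?(ltW c20)// in le_g.
apply: le_lt_trans le_g _; rewrite -cE lt_neqAle ler_real_scalar.
rewrite (inj_eq (@real_scalar_inj R k)) -lt_neqAle.
by rewrite ltr_pdivrMr// ltr_pMr// ltr1n.
Qed.

Lemma iter_right_inverse (V0 : set (Lp k mu p1)) (S : Lp k mu p1 -> Lp k mu p1) m v :
  set_fun V0 V0 S -> (forall v, V0 v -> Tf (S v) = v) -> V0 v ->
  iter m Tf (iter m S v) = v.
Proof.
move=> SV TS Vv; have VS j : V0 (iter j S v) by elim: j => // j IH; exact: SV.
by elim: m => // m IH; rewrite iterSr iterS TS.
Qed.

(** The vectors [w m] stand for the backward orbit [S^m v]. *)
Lemma Lp_power_le_orbit n (v : Lp k mu p1) (w : nat -> Lp k mu p1) :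
  (forall m, iter m Tf (w m) = v) ->
  Lp_power v <= \prod_(i < n) max_mass (mu_ i) *
    \sum_(m < radix alpha n) (Lp_power (iter m Tf v) + Lp_power (w m)).
Proof.
move=> wv.
pose F (x : odometer_space alpha2) := (modulus ((repr v : LpFun k mu p1) x) `^ p)%:E.
pose S m (x : odometer_space alpha2) := (modulus ((repr (w m) : LpFun k mu p1) x) `^ p)%:E.
have mmod (u : LpFun k mu p1) :
    measurable_fun setT (fun x => (modulus (u x) `^ p)%:E).
  by apply: measurable_modulus_powR; exact: LpFun_measurable.
have pos (u : LpFun k mu p1) x : (0 <= (modulus (u x) `^ p)%:E)%E.
  by rewrite lee_fin powR_ge0.
have SF m : {ae mu, forall x, S m (iter m f x) = F x}.
  have [psi psiE] := iter_composition_operator m (repr (w m)).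
  rewrite Lp_classK wv -[v in v = _]Lp_classK => /Lp_classP.
  by apply: filterS => x; rewrite psiE /S /F => ->.
have := integral_le_shifts mu_product
  (fun j jn => mu_cell_le mu_product jn) (mmod (repr v)) (pos (repr v))
  (fun m => mmod (repr (w m))) (fun m => pos (repr (w m))) SF.
rewrite -lee_fin EFinM (Lp_power_repr v) => /(_ n)/le_trans; apply.
rewrite lee_wpmul2l ?lee_fin//; last first.
  rewrite -sumEFin; apply: lee_sum => m _; rewrite EFinD.
  apply: leeD; last by rewrite (Lp_power_repr (w m)).
  have [psi psiE] := iter_composition_operator m (repr v).
  rewrite Lp_classK => ->; rewrite Lp_power_class le_eqVlt; apply/orP; left; apply/eqP.
  by apply: eq_integral => x _; rewrite psiE.
apply: prodr_ge0 => i _; exact: max_mass_ge0.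
Qed.

Lemma not_frequent_hypercyclicity : 2 <= p -> ~ frequent_hypercyclicity_criterion Tf.
Proof.
move=> p2 [V0 [dV0 [S SV HV]]].
(* The space is not trivial: the constant 1 has norm 1. *)
have [v [v0 Vv]] : exists v, v != 0 /\ V0 v.
  have m1 : scalar_measurable (real_scalar \o \1_setT : odometer_space alpha2 -> K).
    exact: digit_function_measurable (digit_function_cells R k (cells_setT alpha2)).
  have P1 : power_integral mu p (real_scalar \o \1_setT : odometer_space alpha2 -> K) = 1%E.
    rewrite -(probability_setT mu) -[RHS]mul1e -integral_cst//.
    by apply: eq_integral => x _; rewrite /= modulus_real_scalar indicT normr1 powR1.
  have [g gE] : {g : LpFun k mu p1 | g = real_scalar \o \1_setT :> (_ -> K)}.
    by apply: LpFunP => //; rewrite P1 ltry.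
  have g1 : `|Lp_class g| = 1 :> K.
    rewrite Lp_norm_powR (_ : Lp_power _ = 1) ?powR1; first by case: (k).
    by apply: EFin_inj; rewrite Lp_power_class gE P1.
  have g0 : Lp_class g != 0 by rewrite -normr_eq0 g1 oner_eq0.
  exact: (dense_neq0 dV0 g0).
have [ucT ucS _] := HV v Vv.
have [M1 HM1] := Lp_cotype p2 ucT.
have [M2 HM2] := Lp_cotype p2 ucS.
have I0 : 0 < Lp_power v.
  rewrite lt_neqAle Lp_power_ge0 andbT eq_sym; apply: contra v0 => /eqP Iv.
  by rewrite -normr_eq0 Lp_norm_powR Iv powR0 ?real_scalar0// invr_eq0 gt_eqF// (lt_le_trans _ p1).
(* The term of index 0 of the orbit sums, absent from the series of the
   criterion, is [Lp_power v] for both orbits. *)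
pose C := 2 * Lp_power v + M1 + M2.
have TSV u : V0 u -> Tf (S u) = u by move=> /HV[].
have le_C n : Lp_power v <= \prod_(i < n) max_mass (mu_ i) * C.
  have := Lp_power_le_orbit n (fun m => iter_right_inverse m SV TSV Vv).
  move=> /le_trans; apply; apply: ler_wpM2l.
    by apply: prodr_ge0 => i _; exact: max_mass_ge0.
  rewrite -(prednK (radix_gt0 alpha2 n)) big_ord_recl/= big_split/=.
  rewrite /C mulr_natl mulr2n -[leRHS]addrA.
  exact: (lerD (lexx _) (lerD (HM1 _) (HM2 _))).
have M1_ge0 : 0 <= M1 by have := HM1 0%N; rewrite big_ord0.
have M2_ge0 : 0 <= M2 by have := HM2 0%N; rewrite big_ord0.
have C0 : 0 < C.
  by rewrite /C -addrA ltr_wpDr ?addr_ge0 ?mulr_gt0.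
have /cvgrPdist_lt/(_ _ (divr_gt0 I0 C0))[N _ /(_ N (leqnn N))] := mu_max.
rewrite sub0r normrN => /(le_lt_trans (ler_norm _)).
by rewrite ltr_pdivlMr// => /(le_lt_trans (le_C N)); rewrite ltxx.
Qed.

End odometer_operator.

Theorem theoremB (R : realType) (k : scalar_kind) (p : R) (p1 : 1 <= p)
    (alpha : nat -> nat) (alpha2 : forall n, (2 <= alpha n)%N)
    (mu_ : forall n, probability (digit alpha2 n) R)
    (mu : probability (odometer_space alpha2) R)
    (mu_gt0 : forall n (a : digit alpha2 n), (0 < mu_ n [set a])%E)
    (mu_product : is_product_measure mu_ mu)
    (mu_max : \prod_(i < n) max_mass (mu_ i) @[n --> \oo] --> 0)
    (Tf : {linear Lp k mu p1 -> Lp k mu p1})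
    (Tf_comp : is_composition_operator (@odometer alpha alpha2) Tf)
    (Tf_cont : continuous Tf) :
  dense (periodic_points Tf) /\
  (2 <= p -> ~ frequent_hypercyclicity_criterion Tf).
Proof.
split; first exact: periodic_points_dense.
exact: (not_frequent_hypercyclicity mu_product mu_max Tf_comp).
Qed.
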